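(* Let $A_i=\begin{pmatrix}a_i&b_i\\c_i&d_i\end{pmatrix}\in\mathbb{R}^{2\times2}$ with $\det A_i=1$ and $b_i>0$ ($i=1,2$). Let $f\in L^1(\mathbb{R}^2,\mathbb{H})$ and let $\mathcal{L}_L^{\mathbf{i},\mathbf{j}}(f)(u,v)=\int_{\mathbb{R}^2}K_{A_1}^{\mathbf{i}}(s,u)K_{A_2}^{\mathbf{j}}(t,v)f(s,t)\,ds\,dt$ be its left-sided quaternion linear canonical transform. If $\mathcal{L}_L^{\mathbf{i},\mathbf{j}}(f)\in L^1(\mathbb{R}^2,\mathbb{H})$, then $$f(s,t)=\int_{\mathbb{R}^2}K_{A_2^{-1}}^{\mathbf{j}}(v,t)\,K_{A_1^{-1}}^{\mathbf{i}}(u,s)\,\mathcal{L}_L^{\mathbf{i},\mathbf{j}}(f)(u,v)\,du\,dv$$ for almost every $(s,t)\in\mathbb{R}^2$.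
   Context: $\mathbb{H}$ is the algebra of quaternions $q=q_0+\mathbf{i}q_1+\mathbf{j}q_2+\mathbf{k}q_3$ ($q_n\in\mathbb{R}$) with the usual Hamilton multiplication ($\mathbf{i}\mathbf{j}=-\mathbf{j}\mathbf{i}=\mathbf{k}$, etc.) and modulus $|q|=(q_0^2+q_1^2+q_2^2+q_3^2)^{1/2}$; $e^{\mathbf{i}\theta}=\cos\theta+\mathbf{i}\sin\theta$ and likewise for $\mathbf{j}$. $L^1(\mathbb{R}^2,\mathbb{H})$ is the space of $f:\mathbb{R}^2\to\mathbb{H}$ with $\int_{\mathbb{R}^2}|f|\,ds\,dt<\infty$; integrals are taken componentwise. Kernels: for a real matrix $A=\begin{pmatrix}a&b\\c&d\end{pmatrix}$ with $\det A=1$, $b\neq0$, and $\mu\in\{\mathbf{i},\mathbf{j}\}$, $K_A^{\mu}(x,y)=\frac{1}{\sqrt{\mu2\pi b}}e^{\mu(\frac{a}{2b}x^2-\frac1bxy+\frac{d}{2b}y^2)}$, where $\sqrt{\mu2\pi b}=\sqrt{2\pi|b|}\,e^{\mu\,\mathrm{sgn}(b)\pi/4}$. Since $A^{-1}=\begin{pmatrix}d&-b\\-c&a\end{pmatrix}$, for $b>0$ one has $K_{A^{-1}}^{\mu}(y,x)=\frac{1}{\sqrt{-\mu2\pi b}}e^{\mu(-\frac{d}{2b}y^2+\frac1bxy-\frac{a}{2b}x^2)}$ with $\sqrt{-\mu2\pi b}=\sqrt{2\pi b}\,e^{-\mu\pi/4}$. *)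

(* Defs.v *)
From HB Require Import structures.
From mathcomp Require Import all_boot all_order all_algebra.
From mathcomp Require Import all_classical all_reals all_analysis.
From mathcomp Require Import measurable_realfun ring.

Set Implicit Arguments.
Unset Strict Implicit.
Unset Printing Implicit Defensive.

Import Order.TTheory GRing.Theory Num.Theory.

Local Open Scope classical_set_scope.
Local Open Scope ring_scope.

Record quat (R : Type) : Type :=
  Quat { qre : R ; qim_i : R ; qim_j : R ; qim_k : R }.

Section QuatChoice.
Context {R : choiceType}.

Definition quat_to_prod (q : quat R) : R * R * R * R :=
  (qre q, qim_i q, qim_j q, qim_k q).
Definition quat_of_prod (p : R * R * R * R) : quat R :=
  Quat p.1.1.1 p.1.1.2 p.1.2 p.2.
Lemma quat_to_prodK : cancel quat_to_prod quat_of_prod.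
Proof. by case. Qed.

HB.instance Definition _ := Choice.copy (quat R) (can_type quat_to_prodK).

End QuatChoice.

Section QuatAlgebra.
Context {R : realType}.
Implicit Types p q r : quat R.

Definition quat0 : quat R := Quat 0 0 0 0.
Definition quat1 : quat R := Quat 1 0 0 0.
Definition quati : quat R := Quat 0 1 0 0.
Definition quatj : quat R := Quat 0 0 1 0.
Definition quatk : quat R := Quat 0 0 0 1.

Definition quat_add p q : quat R :=
  Quat (qre p + qre q) (qim_i p + qim_i q) (qim_j p + qim_j q)
       (qim_k p + qim_k q).
Definition quat_opp p : quat R :=
  Quat (- qre p) (- qim_i p) (- qim_j p) (- qim_k p).
Definition quat_scale (a : R) p : quat R :=
  Quat (a * qre p) (a * qim_i p) (a * qim_j p) (a * qim_k p).
Definition quat_mul p q : quat R :=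
  Quat (qre p * qre q - qim_i p * qim_i q - qim_j p * qim_j q - qim_k p * qim_k q)
       (qre p * qim_i q + qim_i p * qre q + qim_j p * qim_k q - qim_k p * qim_j q)
       (qre p * qim_j q - qim_i p * qim_k q + qim_j p * qre q + qim_k p * qim_i q)
       (qre p * qim_k q + qim_i p * qim_j q - qim_j p * qim_i q + qim_k p * qre q).
Definition quat_conj p : quat R :=
  Quat (qre p) (- qim_i p) (- qim_j p) (- qim_k p).
Definition quat_sqnorm p : R :=
  qre p ^+ 2 + qim_i p ^+ 2 + qim_j p ^+ 2 + qim_k p ^+ 2.
Definition quat_abs p : R := Num.sqrt (quat_sqnorm p).
Definition quat_inv p : quat R :=
  quat_scale (quat_sqnorm p)^-1 (quat_conj p).

Fact quat_addA : associative quat_add.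
Proof. by move=> p q r; rewrite /quat_add /= !addrA. Qed.
Fact quat_addC : commutative quat_add.
Proof. by move=> p q; congr Quat; rewrite addrC. Qed.
Fact quat_add0 : left_id quat0 quat_add.
Proof. by case=> *; rewrite /quat_add /= !add0r. Qed.
Fact quat_addN : left_inverse quat0 quat_opp quat_add.
Proof. by move=> p; rewrite /quat_add /= !addNr. Qed.

HB.instance Definition _ :=
  GRing.isZmodule.Build (quat R) quat_addA quat_addC quat_add0 quat_addN.

Fact quat_mulA : associative quat_mul.
Proof. by move=> p q r; congr Quat; rewrite /=; ring. Qed.
Fact quat_mul1q : left_id quat1 quat_mul.
Proof. by case=> a b c d; congr Quat; rewrite /=; ring. Qed.
Fact quat_mulq1 : right_id quat1 quat_mul.
Proof. by case=> a b c d; congr Quat; rewrite /=; ring. Qed.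
Fact quat_mulDl : left_distributive quat_mul +%R.
Proof. by move=> p q r; congr Quat; rewrite /=; ring. Qed.
Fact quat_mulDr : right_distributive quat_mul +%R.
Proof. by move=> p q r; congr Quat; rewrite /=; ring. Qed.
Fact quat1_neq0 : quat1 != 0 :> quat R.
Proof. by apply/eqP => -[] /eqP; rewrite oner_eq0. Qed.

HB.instance Definition _ := GRing.Zmodule_isNzRing.Build (quat R)
  quat_mulA quat_mul1q quat_mulq1 quat_mulDl quat_mulDr quat1_neq0.

Fact quat_scaleA (a b : R) p :
  quat_scale a (quat_scale b p) = quat_scale (a * b) p.
Proof. by rewrite /quat_scale /= !mulrA. Qed.
Fact quat_scale1 : left_id 1 quat_scale.
Proof. by case=> *; rewrite /quat_scale /= !mul1r. Qed.
Fact quat_scaleDr : right_distributive quat_scale +%R.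
Proof. by move=> a p q; congr Quat; rewrite mulrDr. Qed.
Fact quat_scaleDl p : {morph quat_scale^~ p : a b / a + b}.
Proof. by move=> a b; congr Quat; rewrite mulrDl. Qed.

HB.instance Definition _ := GRing.Zmodule_isLmodule.Build R (quat R)
  quat_scaleA quat_scale1 quat_scaleDr quat_scaleDl.

Fact quat_scaleAl (a : R) p q : a *: (p * q) = (a *: p) * q.
Proof. by congr Quat; rewrite /=; ring. Qed.
HB.instance Definition _ :=
  GRing.Lmodule_isLalgebra.Build R (quat R) quat_scaleAl.

Fact quat_scaleAr (a : R) p q : a *: (p * q) = p * (a *: q).
Proof. by congr Quat; rewrite /=; ring. Qed.
HB.instance Definition _ :=
  GRing.Lalgebra_isAlgebra.Build R (quat R) quat_scaleAr.

Lemma quat_sqnorm_eq0 p : (quat_sqnorm p == 0) = (p == 0).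
Proof.
apply/eqP/eqP => [|->]; last by rewrite /quat_sqnorm /= !expr0n /= !addr0.
case: p => a b c d; rewrite /quat_sqnorm /= => /eqP.
rewrite !paddr_eq0 ?addr_ge0 ?sqr_ge0// !sqrf_eq0.
by move=> /andP[/andP[/andP[/eqP-> /eqP->] /eqP->] /eqP->].
Qed.

Fact quat_mulVq : {in predC1 (0 : quat R), left_inverse 1 quat_inv *%R}.
Proof.
move=> p; rewrite inE/= -quat_sqnorm_eq0; case: p => a b c d.
rewrite /quat_sqnorm/= => h.
by congr Quat; rewrite /= /quat_sqnorm/=; field.
Qed.
Fact quat_mulqV : {in predC1 (0 : quat R), right_inverse 1 quat_inv *%R}.
Proof.
move=> p; rewrite inE/= -quat_sqnorm_eq0; case: p => a b c d.
rewrite /quat_sqnorm/= => h.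
by congr Quat; rewrite /= /quat_sqnorm/=; field.
Qed.
Fact quat_unitP p q : q * p = 1 /\ p * q = 1 -> predC1 (0 : quat R) p.
Proof.
move=> [qp _]; rewrite /=; apply/eqP => p0; move: qp; rewrite p0 mulr0.
by move/esym/eqP; rewrite oner_eq0.
Qed.
Fact quat_inv_out : {in [predC predC1 (0 : quat R)], quat_inv =1 id}.
Proof.
move=> p; rewrite inE/= negbK => /eqP->.
by rewrite /quat_inv /quat_scale /=; congr Quat; rewrite ?oppr0 mulr0.
Qed.

HB.instance Definition _ := GRing.NzRing_hasMulInverse.Build (quat R)
  quat_mulVq quat_mulqV quat_unitP quat_inv_out.

Lemma quat_mulij : quati * quatj = quatk.
Proof. by congr Quat; rewrite /=; ring. Qed.
Lemma quat_mulji : quatj * quati = - quatk.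
Proof. by congr Quat; rewrite /=; ring. Qed.
Lemma quat_mulii : quati * quati = -1.
Proof. by congr Quat; rewrite /=; ring. Qed.
Lemma quat_muljj : quatj * quatj = -1.
Proof. by congr Quat; rewrite /=; ring. Qed.

(* e^{mu x}, meaningful for mu a square root of -1 *)
Definition quat_expi (mu : quat R) (x : R) : quat R :=
  cos x *: 1 + sin x *: mu.

(* sqrt (mu 2 pi b), with the branch fixed by the sign of b *)
Definition quat_sqrt2pi (mu : quat R) (b : R) : quat R :=
  Num.sqrt (2 * pi * `|b|) *: quat_expi mu (Num.sg b * (pi / 4)).

Definition qlct_kernel (mu : quat R) (A : 'M[R]_2) (x y : R) : quat R :=
  let a := A 0 0 in let b := A 0 1 in let d := A 1 1 in
  (quat_sqrt2pi mu b)^-1 *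
  quat_expi mu (a / (2 * b) * x ^+ 2 - b^-1 * x * y + d / (2 * b) * y ^+ 2).

End QuatAlgebra.

Notation lebesgue2 R := (@lebesgue_measure R \x @lebesgue_measure R)%E.

Section QuatIntegral.
Context {R : realType}.

Definition lebesgue2_measurable (g : R * R -> R) : Prop :=
  forall B : set R, measurable B ->
    completed_algebra_gen (lebesgue2 R) (g @^-1` B).

(* The library integral is a supremum over Borel simple functions; as every
   Lebesgue measurable function agrees with a Borel one off a Borel null set,
   it has the usual value on all Lebesgue measurable functions. *)
Definition quat_L1 (f : R * R -> quat R) : Prop :=
  [/\ lebesgue2_measurable (fun z => qre (f z)),
      lebesgue2_measurable (fun z => qim_i (f z)),
      lebesgue2_measurable (fun z => qim_j (f z)),
      lebesgue2_measurable (fun z => qim_k (f z)) &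
      (\int[lebesgue2 R]_z (quat_abs (f z))%:E < +oo)%E].

Definition quat_integral (f : R * R -> quat R) : quat R :=
  Quat (\int[lebesgue2 R]_z qre (f z)) (\int[lebesgue2 R]_z qim_i (f z))
       (\int[lebesgue2 R]_z qim_j (f z)) (\int[lebesgue2 R]_z qim_k (f z)).

Definition left_qlct (A1 A2 : 'M[R]_2) (f : R * R -> quat R) (w : R * R) :
    quat R :=
  quat_integral (fun z =>
    qlct_kernel quati A1 z.1 w.1 * qlct_kernel quatj A2 z.2 w.2 * f z).

End QuatIntegral.

(* Main.v *)
Require Import Defs.
From mathcomp Require Import all_boot all_order all_algebra.
From mathcomp Require Import all_classical all_reals all_analysis.
From mathcomp Require Import measurable_realfun ring lra.
Import Order.TTheory GRing.Theory Num.Theory.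
Import numFieldNormedType.Exports.
Set Implicit Arguments.
Unset Strict Implicit.
Unset Printing Implicit Defensive.
Local Open Scope classical_set_scope.
Local Open Scope ring_scope.

(** Left multiplication by the exponentials of one imaginary unit [mu] makes the
    quaternions a complex vector space, so the one-variable theory is that of the
    complex Fourier transform; only the interaction of the two units [i] and [j] is
    specific to quaternions.

    One variable. The phase of the kernel is $p(x) - xy/b + r(y)$, and up to the chirps
    $e^{\mu p}$ and $e^{\mu r}$, which can be moved to the function and its transform,
    the kernel is a Fourier kernel ([chirp_inversion]). The kernel of the inverse matrix
    has the opposite phase ([qlct_kernel_invE]). Fourier inversion ([fourier_inversion])
    is proved by Abel summation: with the factor $e^{-\varepsilon|y|}$ in the inversion
    integral, Fubini turns it into a convolution with the Poisson kernel. Its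
    integral over $[a,b]$ is the integral of the function against a difference of two
    arctangents, which tends boundedly to a multiple of the indicator function of
    $[a,b]$. So both sides of the inversion formula have the same integral over every
    interval ([fourier_inversion_itv]), and Lebesgue differentiation ([ae_eq0_itv]) makes them
    equal almost everywhere.

    Two variables. Transform in $t$ first, with values $h(s,v)$, and then in $s$; the
    result is the transform $F(u,v)$. As $F$ is integrable, almost all of its sections
    $F(\cdot,v)$ are, and inversion in the first variable gives
    $h(s,v) = \int K^{-1}(u,s) F(u,v)\,du$ for almost every $v$ and almost every $s$.
    The right hand side is integrable in $v$ for every $s$, so that inversion in the
    second variable applies to $h(s,\cdot)$ and recovers $f(s,\cdot)$ for almost every
    $s$ ([plane_inversion]). Exchanging the almost-everywhere quantifiers requires
    joint measurability ([ae_prod1], [ae_prod2]).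

    A Lebesgue measurable [f] is first modified on a null set to become Borel, which
    changes none of its integral transforms ([qmodification], [qint_setC_null]). *)

(** * Real integrals: almost everywhere equality and Fubini *)

Section RealIntegral.
Context d (T : measurableType d) (R : realType) (m : {measure set T -> \bar R}).
Implicit Types f g h : T -> R.

Lemma measurable_fun_EFin_comp f :
  m.-integrable setT (EFin \o f) -> measurable_fun setT f.
Proof. by move=> /measurable_int/measurable_EFinP. Qed.

Lemma ae_eq_Rintegral f g :
  measurable_fun setT f -> measurable_fun setT g ->
  {ae m, forall x, f x = g x} -> \int[m]_x f x = \int[m]_x g x.
Proof.
move=> mf mg fg; congr fine; apply: ae_eq_integral => //;
  [exact/measurable_EFinP|exact/measurable_EFinP|].
by apply: filterS fg => x /= -> _.
Qed.

Lemma ae_eq_integrable f g :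
  measurable_fun setT f -> m.-integrable setT (EFin \o g) ->
  {ae m, forall x, f x = g x} -> m.-integrable setT (EFin \o f).
Proof.
move=> mf ig fg; apply/integrableP; split; first exact/measurable_EFinP.
have mg := measurable_fun_EFin_comp ig.
have /integrableP[_ goo] := ig.
rewrite (_ : (\int[m]_x _)%E = \int[m]_x `|(g x)%:E|)%E//.
apply: ae_eq_integral => //.
- by apply: measurableT_comp => //; exact/measurable_EFinP.
- by apply: measurableT_comp => //; exact/measurable_EFinP.
by apply: filterS fg => x /= -> _.
Qed.

Lemma integrable_bounded_mul h f (M : R) :
  measurable_fun setT h -> (forall x, `|h x| <= M) ->
  m.-integrable setT (EFin \o f) ->
  m.-integrable setT (EFin \o (fun x => h x * f x)).
Proof.
move=> mh hM fi.
have mf := measurable_fun_EFin_comp fi.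
apply: (le_integrable measurableT _ _ (integrableZl measurableT M fi)).
  by apply/measurable_EFinP; exact: measurable_funM.
move=> x _ /=; rewrite lee_fin !normrM ler_wpM2r//.
exact: le_trans (hM x) (ler_norm _).
Qed.

Lemma Rintegral_dominated_cvg (f_ : nat -> T -> R) f g :
  (forall n, measurable_fun setT (f_ n)) -> measurable_fun setT f ->
  m.-integrable setT (EFin \o g) ->
  (forall n x, `|f_ n x| <= g x) ->
  {ae m, forall x, f_ n x @[n --> \oo] --> f x} ->
  \int[m]_x f_ n x @[n --> \oo] --> \int[m]_x f x.
Proof.
move=> mf_ mf ig fg cvf.
have [] := @dominated_convergence _ _ _ m setT measurableT
  (fun n => EFin \o f_ n) (EFin \o f) (EFin \o g).
- by move=> n; exact/measurable_EFinP.
- exact/measurable_EFinP.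
- apply: filterS cvf => x /= fx _.
  by apply/cvg_EFin; [exact: nearW|exact: fx].
- exact: ig.
- by apply: aeW => x /= n _; rewrite lee_fin.
move=> fi _ cvg_int.
by apply: (fine_cvg); rewrite fineK //; exact: integrable_fin_num.
Qed.

End RealIntegral.

Section RealFubini.
Context d1 d2 (T1 : measurableType d1) (T2 : measurableType d2) (R : realType).
Variables (m1 : {sigma_finite_measure set T1 -> \bar R})
  (m2 : {sigma_finite_measure set T2 -> \bar R}).
Implicit Types f : T1 * T2 -> R.
Local Notation m12 := (m1 \x m2)%E.

(** The integrals of the positive and negative parts depend measurably on the
    parameter by Tonelli, and taking the finite part of their difference is a
    measurable operation even where it is infinite. *)
Lemma measurable_fun_Rintegral f : measurable_fun setT f ->
  measurable_fun setT (fun x => \int[m2]_y f (x, y)).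
Proof.
move=> /measurable_EFinP mf; apply: measurableT_comp => //.
rewrite (_ : (fun x => _) = (fun x => \int[m2]_y (EFin \o f)^\+ (x, y) -
    \int[m2]_y (EFin \o f)^\- (x, y)))%E; last first.
  apply/funext => x; rewrite integralE.
  by congr (_ - _)%E; apply: eq_integral => y _; rewrite ?funeposE ?funenegE.
apply: emeasurable_funB.
- apply: (measurable_fun_fubini_tonelli_F (EFin \o f)^\+%E) => //.
  exact: measurable_funepos.
- apply: (measurable_fun_fubini_tonelli_F (EFin \o f)^\-%E) => //.
  exact: measurable_funeneg.
Qed.

Lemma integrable_Rintegral1 f : m12.-integrable setT (EFin \o f) ->
  m1.-integrable setT (EFin \o (fun x => \int[m2]_y f (x, y))).
Proof.
move=> fi; have mf := measurable_fun_EFin_comp fi.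
apply: le_integrable (integrable_fubini_F fi) => //.
  by apply/measurable_EFinP; exact: measurable_fun_Rintegral.
move=> x _ /=; rewrite /Rintegral /fubini_F.
by case: (\int[m2]_y _)%E => [r| |] //=; rewrite ?normr0 ?leey.
Qed.

(** The inner real integral is the finite part of the extended one, so both agree
    only for those sections that are integrable, that is, almost everywhere. *)
Lemma Rintegral12 f : m12.-integrable setT (EFin \o f) ->
  \int[m12]_z f z = \int[m1]_x \int[m2]_y f (x, y).
Proof.
move=> fi; congr fine; rewrite -(integral12_prod_meas1 fi).
apply: ae_eq_integral => //.
- exact: measurable_fubini_F fi.
- by have /measurable_EFinP :=
    measurable_fun_Rintegral (measurable_fun_EFin_comp fi).
apply: filterS (ae_integrable1 fi) => x fix_ _ /=.
by rewrite /fubini_F /Rintegral fineK//; exact: integrable_fin_num.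
Qed.

End RealFubini.

Section RealFubiniSwap.
Context d1 d2 (T1 : measurableType d1) (T2 : measurableType d2) (R : realType).
Variables (m1 : {sigma_finite_measure set T1 -> \bar R})
  (m2 : {sigma_finite_measure set T2 -> \bar R}).
Implicit Types f : T1 * T2 -> R.

Lemma integrable_swap f : (m1 \x m2)%E.-integrable setT (EFin \o f) ->
  (m2 \x m1)%E.-integrable setT (EFin \o (fun z => f (z.2, z.1))).
Proof.
move=> fi; have mf := measurable_fun_EFin_comp fi.
apply/integrable12ltyP => /=.
  apply/measurable_EFinP; apply: measurableT_comp => //.
  exact: measurable_swap.
by have := fi => /(integrable21ltyP _ _ (measurable_int _ fi)).
Qed.

Lemma Rintegral_swap f : (m1 \x m2)%E.-integrable setT (EFin \o f) ->
  \int[(m1 \x m2)%E]_z f z = \int[(m2 \x m1)%E]_z f (z.2, z.1).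
Proof.
move=> fi; rewrite (Rintegral12 (integrable_swap fi)) /=.
congr fine; rewrite -(integral21_prod_meas1 fi).
apply: ae_eq_integral => //.
- exact: measurable_fubini_G fi.
- by have /measurable_EFinP := measurable_fun_Rintegral m1
    (measurable_fun_EFin_comp (integrable_swap fi)).
apply: filterS (ae_integrable2 fi) => x fix_ _ /=.
by rewrite /fubini_G /Rintegral fineK//; exact: integrable_fin_num.
Qed.

Lemma integrable_tensor (f : T1 -> R) (g : T2 -> R) :
  m1.-integrable setT (EFin \o f) -> m2.-integrable setT (EFin \o g) ->
  (m1 \x m2)%E.-integrable setT (EFin \o (fun z => f z.1 * g z.2)).
Proof.
move=> fi gi.
have mf := measurable_fun_EFin_comp fi.
have mg := measurable_fun_EFin_comp gi.
apply/integrable12ltyP => /=.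
  apply/measurable_EFinP; apply: measurable_funM.
    exact: measurableT_comp mf measurable_fst.
  exact: measurableT_comp mg measurable_snd.
under eq_integral => x _.
  under eq_integral => y _ do rewrite normrM EFinM.
  rewrite ge0_integralZl//; last first.
    by apply/measurable_EFinP; exact: measurableT_comp.
  over.
have /integrableP[_ foo] := fi; have /integrableP[_ goo] := gi.
rewrite ge0_integralZr//.
- apply: lte_mul_pinfty => //; first exact: integral_ge0.
  by rewrite ge0_fin_numE//; exact: integral_ge0.
- by apply/measurable_EFinP; exact: measurableT_comp.
- exact: integral_ge0.
Qed.

End RealFubiniSwap.

Section AeFubini.
Context d1 d2 (T1 : measurableType d1) (T2 : measurableType d2) (R : realType).
Variables (m1 : {sigma_finite_measure set T1 -> \bar R})
  (m2 : {sigma_finite_measure set T2 -> \bar R}).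

(** With [ae_prod2], this exchanges two nested almost-everywhere quantifiers,
    at the price of the measurability of the set in the product. *)
Lemma ae_prod1 (A : set (T1 * T2)) : measurable A ->
  {ae (m1 \x m2)%E, forall z, A z} <->
  {ae m1, forall x, {ae m2, forall y, A (x, y)}}.
Proof.
move=> mA; have mCA := measurableC mA.
have secE x : ~` [set y | A (x, y)] = xsection (~` A) x.
  by apply/seteqP; split => y; rewrite /xsection /= ?inE.
have msec x : measurable (xsection (~` A) x) by exact: measurable_xsection.
have mF := measurable_fun_xsection m2 mCA.
have -> : {ae (m1 \x m2)%E, forall z, A z} <->
    ae_eq m1 setT (m2 \o xsection (~` A)) (cst 0%E).
  rewrite -(ae_eq_integral_abs m1 measurableT mF).
  rewrite /= (_ : (\int[m1]_x _)%E = (m1 \x m2)%E (~` A)).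
    exact: (negligibleP (m1 \x m2)%E mCA).
  by apply: eq_integral => x _; rewrite gee0_abs.
have secP x : {ae m2, forall y, A (x, y)} <-> m2 (xsection (~` A) x) = 0%E.
  by rewrite -(negligibleP m2 (msec x)) -secE.
by split; apply: filterS => x /=; [move=> /(_ I) /secP|move=> /secP].
Qed.

Lemma ae_prod2 (A : set (T1 * T2)) : measurable A ->
  {ae (m1 \x m2)%E, forall z, A z} <->
  {ae m2, forall y, {ae m1, forall x, A (x, y)}}.
Proof.
move=> mA; have mCA := measurableC mA.
have secE y : ~` [set x | A (x, y)] = ysection (~` A) y.
  by apply/seteqP; split => x; rewrite /ysection /= ?inE.
have msec y : measurable (ysection (~` A) y) by exact: measurable_ysection.
have mF := measurable_fun_ysection m1 mCA.
have -> : {ae (m1 \x m2)%E, forall z, A z} <->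
    ae_eq m2 setT (m1 \o ysection (~` A)) (cst 0%E).
  rewrite -(ae_eq_integral_abs m2 measurableT mF).
  rewrite /= (_ : (\int[m2]_x _)%E = (m1 \x m2)%E (~` A)).
    exact: (negligibleP (m1 \x m2)%E mCA).
  transitivity ((m1 \x^ m2)%E (~` A)).
    by apply: eq_integral => y _; rewrite gee0_abs.
  apply/esym/product_measure_unique => // B C mB mC.
  exact: product_measure2E.
have secP y : {ae m1, forall x, A (x, y)} <-> m1 (ysection (~` A) y) = 0%E.
  by rewrite -(negligibleP m1 (msec y)) -secE.
by split; apply: filterS => y /=; [move=> /(_ I) /secP|move=> /secP].
Qed.
End AeFubini.

(** * Quaternion valued functions and their integrals *)

(** The four real coordinates are indexed by a type, so that a property of
    quaternion valued functions can be stated and proved for all coordinates at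
    once. *)
Variant quat_index := QRe | QI | QJ | QK.

Definition qcoord {R : Type} (c : quat_index) (q : quat R) : R :=
  match c with QRe => qre q | QI => qim_i q | QJ => qim_j q | QK => qim_k q end.

Lemma eq_qcoord (R : Type) (p q : quat R) :
  (forall c, qcoord c p = qcoord c q) -> p = q.
Proof.
case: p q => [a b c d] [a' b' c' d'] h.
by have /= -> := h QRe; have /= -> := h QI; have /= -> := h QJ;
  have /= -> := h QK.
Qed.

Section QuatCoord.
Context {R : realType}.
Implicit Types p q mu : quat R.

Lemma qcoordD c p q : qcoord c (p + q) = qcoord c p + qcoord c q.
Proof. by case: c. Qed.

Lemma qcoordZ c (a : R) q : qcoord c (a *: q) = a * qcoord c q.
Proof. by case: c. Qed.

Lemma qcoord0 c : qcoord c (0 : quat R) = 0.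
Proof. by case: c. Qed.

Lemma qcoord_le_abs c q : `|qcoord c q| <= quat_abs q.
Proof.
rewrite -sqrtr_sqr ler_wsqrtr// /quat_sqnorm.
have := sqr_ge0 (qre q); have := sqr_ge0 (qim_i q).
have := sqr_ge0 (qim_j q); have := sqr_ge0 (qim_k q).
by case: c => /=; lra.
Qed.

(** A coordinate of a left multiple is a fixed real linear form of the coordinates:
    this is how integration commutes with left multiplication by a constant. *)
Lemma qcoord_mul c p : exists a : quat_index -> R,
  forall q, qcoord c (p * q) = a QRe * qcoord QRe q + a QI * qcoord QI q +
    a QJ * qcoord QJ q + a QK * qcoord QK q.
Proof.
exists (fun e => qcoord c (p * match e with QRe => quat1 | QI => quati
  | QJ => quatj | QK => quatk end)).
by move=> q; case: c => /=; ring.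
Qed.

(** For a square root [mu] of -1, the functional equation of the exponential holds
    in the commutative plane spanned by 1 and [mu]. *)
Lemma quat_expiD mu x y : mu * mu = -1 ->
  quat_expi mu (x + y) = quat_expi mu x * quat_expi mu y.
Proof.
move=> mu2; rewrite /quat_expi cosD sinD mulrDl !mulrDr.
rewrite -!scalerAl -!scalerAr !scalerA !mul1r mulr1 mu2.
by apply: eq_qcoord; case=> /=; ring.
Qed.

Lemma quat_expi0 mu : quat_expi mu 0 = 1.
Proof. by rewrite /quat_expi cos0 sin0 scale1r scale0r addr0. Qed.

Lemma quat_expiNK mu x q : mu * mu = -1 ->
  quat_expi mu (- x) * (quat_expi mu x * q) = q.
Proof. by move=> mu2; rewrite mulrA -quat_expiD// addNr quat_expi0 mul1r. Qed.

(** Left multiplication by an exponential is a combination, with bounded real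
    coefficients, of the identity and of a constant left multiplication. *)
Lemma quat_expiM mu x q : quat_expi mu x * q = cos x *: q + sin x *: (mu * q).
Proof. by rewrite /quat_expi mulrDl -!scalerAl mul1r. Qed.

End QuatCoord.

Definition qmeasurable d (T : measurableType d) (R : realType)
    (f : T -> quat R) : Prop :=
  forall c, measurable_fun setT (fun x => qcoord c (f x)).

Definition qintegrable d (T : measurableType d) (R : realType)
    (m : {measure set T -> \bar R}) (f : T -> quat R) : Prop :=
  forall c, m.-integrable setT (EFin \o (fun x => qcoord c (f x))).

Definition qint d (T : measurableType d) (R : realType)
    (m : {measure set T -> \bar R}) (f : T -> quat R) : quat R :=
  Quat (\int[m]_x qre (f x)) (\int[m]_x qim_i (f x))
       (\int[m]_x qim_j (f x)) (\int[m]_x qim_k (f x)).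

Section QuatIntegral.
Context d (T : measurableType d) (R : realType) (m : {measure set T -> \bar R}).
Implicit Types (f g : T -> quat R) (mu q : quat R).

Lemma qcoord_qint c f : qcoord c (qint m f) = \int[m]_x qcoord c (f x).
Proof. by case: c. Qed.

Lemma qintegrable_measurable f : qintegrable m f -> qmeasurable f.
Proof. by move=> fi c; exact: measurable_fun_EFin_comp (fi c). Qed.

Lemma qmeasurableD f g : qmeasurable f -> qmeasurable g ->
  qmeasurable (fun x => f x + g x).
Proof.
move=> mf mg c; under eq_fun do rewrite qcoordD; exact: measurable_funD.
Qed.

Lemma qmeasurableZ (r : T -> R) f : measurable_fun setT r -> qmeasurable f ->
  qmeasurable (fun x => r x *: f x).
Proof.
by move=> mr mf c; under eq_fun do rewrite qcoordZ; exact: measurable_funM.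
Qed.

Lemma qmeasurable_mull q f : qmeasurable f -> qmeasurable (fun x => q * f x).
Proof.
move=> mf c; have [a aE] := qcoord_mul c q; under eq_fun do rewrite aE.
by do ![apply: measurable_funD]; apply: measurable_funM => //; exact: mf.
Qed.

Lemma measurable_cos (th : T -> R) : measurable_fun setT th ->
  measurable_fun setT (fun x => cos (th x)).
Proof.
move=> mth; apply: measurableT_comp mth.
by apply: continuous_measurable_fun; exact: continuous_cos.
Qed.

Lemma measurable_sin (th : T -> R) : measurable_fun setT th ->
  measurable_fun setT (fun x => sin (th x)).
Proof.
move=> mth; apply: measurableT_comp mth.
by apply: continuous_measurable_fun; exact: continuous_sin.
Qed.

Lemma qmeasurable_expi mu (th : T -> R) f : measurable_fun setT th ->
  qmeasurable f -> qmeasurable (fun x => quat_expi mu (th x) * f x).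
Proof.
move=> mth mf.
under eq_fun do rewrite quat_expiM.
apply: qmeasurableD; apply: qmeasurableZ => //.
- exact: measurable_cos.
- exact: measurable_sin.
- exact: qmeasurable_mull.
Qed.

Lemma qintegrableD f g : qintegrable m f -> qintegrable m g ->
  qintegrable m (fun x => f x + g x).
Proof.
move=> fi gi c; rewrite (_ : _ \o _ = (EFin \o (fun x => qcoord c (f x))) \+
   (EFin \o (fun x => qcoord c (g x))))%E; first exact: integrableD.
by apply/funext => x /=; rewrite qcoordD EFinD.
Qed.

Lemma qintegrable_bounded_scale (r : T -> R) (M : R) f :
  measurable_fun setT r -> (forall x, `|r x| <= M) -> qintegrable m f ->
  qintegrable m (fun x => r x *: f x).
Proof.
move=> mr rM fi c; under eq_fun do rewrite qcoordZ.
exact: integrable_bounded_mul mr rM (fi c).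
Qed.

Lemma qintegrableZ (a : R) f : qintegrable m f -> qintegrable m (fun x => a *: f x).
Proof. by move=> fi; apply: (@qintegrable_bounded_scale _ `|a|). Qed.

Lemma integrable_addr (f g : T -> R) :
  m.-integrable setT (EFin \o f) -> m.-integrable setT (EFin \o g) ->
  m.-integrable setT (EFin \o (fun x => f x + g x)).
Proof. by move=> fi gi; exact: (integrableD measurableT fi gi). Qed.

Lemma integrable_lin4 (a : quat_index -> R) f : qintegrable m f ->
  m.-integrable setT (EFin \o (fun x => a QRe * qcoord QRe (f x) +
    a QI * qcoord QI (f x) + a QJ * qcoord QJ (f x) +
    a QK * qcoord QK (f x))).
Proof.
move=> fi.
have ZI e : m.-integrable setT (EFin \o (fun x => a e * qcoord e (f x))).
  exact: integrableZl (fi e).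
by do 3![apply: integrable_addr => //]; exact: ZI.
Qed.

Lemma Rintegral_lin4 (a : quat_index -> R) f : qintegrable m f ->
  \int[m]_x (a QRe * qcoord QRe (f x) + a QI * qcoord QI (f x) +
    a QJ * qcoord QJ (f x) + a QK * qcoord QK (f x)) =
  a QRe * \int[m]_x qcoord QRe (f x) + a QI * \int[m]_x qcoord QI (f x) +
    a QJ * \int[m]_x qcoord QJ (f x) + a QK * \int[m]_x qcoord QK (f x).
Proof.
move=> fi.
have ZI e : m.-integrable setT (EFin \o (fun x => a e * qcoord e (f x))).
  exact: integrableZl (fi e).
have ZID e1 e2 : m.-integrable setT (EFin \o (fun x => a e1 * qcoord e1 (f x)
  + a e2 * qcoord e2 (f x))) by do ?exact: integrable_addr.
have ZIDD e1 e2 e3 : m.-integrable setT (EFin \o (fun x => a e1 * qcoord e1 (f x)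
  + a e2 * qcoord e2 (f x) + a e3 * qcoord e3 (f x))) by do ?exact: integrable_addr.
rewrite (RintegralD measurableT (ZIDD _ _ _) (ZI _)).
rewrite (RintegralD measurableT (ZID _ _) (ZI _)).
rewrite (RintegralD measurableT (ZI _) (ZI _)).
by rewrite !(RintegralZl _ measurableT (fi _)).
Qed.

Lemma qintegrable_mull q f : qintegrable m f -> qintegrable m (fun x => q * f x).
Proof.
move=> fi c; have [a aE] := qcoord_mul c q; under eq_fun do rewrite aE.
exact: integrable_lin4.
Qed.

Lemma qint_mull q f : qintegrable m f ->
  qint m (fun x => q * f x) = q * qint m f.
Proof.
move=> fi; apply: eq_qcoord => c; have [a aE] := qcoord_mul c q.
rewrite aE !qcoord_qint.
under eq_Rintegral do rewrite aE.
exact: Rintegral_lin4.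
Qed.

Lemma qintZ (a : R) f : qintegrable m f ->
  qint m (fun x => a *: f x) = a *: qint m f.
Proof.
move=> fi; apply: eq_qcoord => c; rewrite qcoordZ !qcoord_qint.
under eq_Rintegral do rewrite qcoordZ.
by rewrite RintegralZl//; exact: fi.
Qed.

Lemma qintegrable_expi mu (th : T -> R) f : measurable_fun setT th ->
  qintegrable m f -> qintegrable m (fun x => quat_expi mu (th x) * f x).
Proof.
move=> mth fi; under eq_fun do rewrite quat_expiM.
apply: qintegrableD; apply: (@qintegrable_bounded_scale _ 1) => //.
- exact: measurable_cos.
- by move=> x; exact: cos_max.
- exact: measurable_sin.
- by move=> x; exact: sin_max.
- exact: qintegrable_mull.
Qed.

Lemma measurable_qeq f g :
  qmeasurable f -> qmeasurable g -> measurable [set x | f x = g x].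
Proof.
move=> mf mg.
have mE c : measurable [set x | qcoord c (f x) = qcoord c (g x)].
  rewrite -[X in measurable X]setTI.
  rewrite (_ : [set x | _] = [set x | (qcoord c (f x) == qcoord c (g x))]).
    exact: measurable_fun_eqr.
  by apply/seteqP; split => x /= /eqP.
rewrite (_ : [set x | _] = [set x | qcoord QRe (f x) = qcoord QRe (g x)] `&`
 [set x | qcoord QI (f x) = qcoord QI (g x)] `&`
 [set x | qcoord QJ (f x) = qcoord QJ (g x)] `&`
 [set x | qcoord QK (f x) = qcoord QK (g x)]).
  by do 3![apply: measurableI => //].
apply/seteqP; split => x /= => [->//|[[[h1 h2] h3] h4]].
by apply: eq_qcoord; case.
Qed.

Lemma ae_eq_qint f g : qmeasurable f -> qmeasurable g ->
  {ae m, forall x, f x = g x} -> qint m f = qint m g.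
Proof.
move=> mf mg fg; apply: eq_qcoord => c; rewrite !qcoord_qint.
apply: ae_eq_Rintegral; [exact: mf|exact: mg|].
by apply: filterS fg => x ->.
Qed.

Lemma ae_eq_qintegrable f g : qmeasurable f -> qintegrable m g ->
  {ae m, forall x, f x = g x} -> qintegrable m f.
Proof.
move=> mf gi fg c; apply: (ae_eq_integrable (mf c) (gi c)).
by apply: filterS fg => x ->.
Qed.

Lemma ae_eq_qcoord f g :
  (forall c, {ae m, forall x, qcoord c (f x) = qcoord c (g x)}) ->
  {ae m, forall x, f x = g x}.
Proof.
move=> h; apply: filterS (filterI (filterI (h QRe) (h QI))
  (filterI (h QJ) (h QK))) => x /= [[? ?] [? ?]].
by apply: eq_qcoord; case.
Qed.

Lemma eq_qint f g : f =1 g -> qint m f = qint m g.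
Proof. by move=> /funext ->. Qed.

(** The constant factor on the right can be taken out because the coefficients
    [cos] and [sin] of the exponential are real, hence central. *)
Lemma qint_expi_scale mu (w th : T -> R) q : measurable_fun setT th ->
  m.-integrable setT (EFin \o w) ->
  qint m (fun x => w x *: (quat_expi mu (th x) * q)) =
  (\int[m]_x (w x * cos (th x))) *: q +
  (\int[m]_x (w x * sin (th x))) *: (mu * q).
Proof.
move=> mth wi; apply: eq_qcoord => c; rewrite qcoord_qint qcoordD !qcoordZ.
have wci : m.-integrable setT (EFin \o (fun x => w x * cos (th x))).
  under eq_fun do rewrite mulrC.
  apply: (@integrable_bounded_mul _ _ _ _ _ _ 1) => //.
    exact: measurable_cos.
  by move=> x; exact: cos_max.
have wsi : m.-integrable setT (EFin \o (fun x => w x * sin (th x))).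
  under eq_fun do rewrite mulrC.
  apply: (@integrable_bounded_mul _ _ _ _ _ _ 1) => //.
    exact: measurable_sin.
  by move=> x; exact: sin_max.
under eq_Rintegral do rewrite quat_expiM scalerDr qcoordD !scalerA !qcoordZ.
rewrite RintegralD//.
- by rewrite !RintegralZr.
- exact: integrableZr wci.
- exact: integrableZr wsi.
Qed.

End QuatIntegral.

Section QuatFubini.
Context d1 d2 (T1 : measurableType d1) (T2 : measurableType d2) (R : realType).
Variables (m1 : {sigma_finite_measure set T1 -> \bar R})
  (m2 : {sigma_finite_measure set T2 -> \bar R}).
Implicit Types f g : T1 * T2 -> quat R.
Local Notation m12 := (m1 \x m2)%E.

Lemma qmeasurable_qint f : qmeasurable f ->
  qmeasurable (fun x => qint m2 (fun y => f (x, y))).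
Proof.
move=> mf c; under eq_fun do rewrite qcoord_qint.
exact: (measurable_fun_Rintegral m2 (mf c)).
Qed.

Lemma qintegrable_qint f : qintegrable m12 f ->
  qintegrable m1 (fun x => qint m2 (fun y => f (x, y))).
Proof.
move=> fi c; under eq_fun do rewrite qcoord_qint.
exact: (integrable_Rintegral1 (fi c)).
Qed.

Lemma qint12 f : qintegrable m12 f ->
  qint m12 f = qint m1 (fun x => qint m2 (fun y => f (x, y))).
Proof.
move=> fi; apply: eq_qcoord => c; rewrite !qcoord_qint.
under [RHS]eq_Rintegral do rewrite qcoord_qint.
exact: (Rintegral12 (fi c)).
Qed.

Lemma ae_qintegrable f : qintegrable m12 f ->
  {ae m1, forall x, qintegrable m2 (fun y => f (x, y))}.
Proof.
move=> fi.
have h c := ae_integrable1 (fi c).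
apply: filterS (filterI (filterI (h QRe) (h QI))
  (filterI (h QJ) (h QK))) => x /= [[? ?] [? ?]].
by case.
Qed.

Lemma qmeasurable_section1 f x : qmeasurable f ->
  qmeasurable (fun y => f (x, y)).
Proof. by move=> mf c; exact: measurableT_comp (mf c) (pair1_measurable x). Qed.

End QuatFubini.

Section QuatFubiniSwap.
Context d1 d2 (T1 : measurableType d1) (T2 : measurableType d2) (R : realType).
Variables (m1 : {sigma_finite_measure set T1 -> \bar R})
  (m2 : {sigma_finite_measure set T2 -> \bar R}).
Implicit Types f g : T1 * T2 -> quat R.
Local Notation m12 := (m1 \x m2)%E.

Lemma qintegrable_swap f : qintegrable m12 f ->
  qintegrable (m2 \x m1)%E (fun z => f (z.2, z.1)).
Proof. by move=> fi c; exact: (integrable_swap (fi c)). Qed.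

Lemma qint21 f : qintegrable m12 f ->
  qint m12 f = qint m2 (fun y => qint m1 (fun x => f (x, y))).
Proof.
move=> fi; rewrite -(qint12 (qintegrable_swap fi)).
apply: eq_qcoord => c; rewrite !qcoord_qint.
exact: (Rintegral_swap (fi c)).
Qed.

End QuatFubiniSwap.

(** * Functions measurable up to null sets *)

Section LebesgueMeasurable.
Context d (T : measurableType d) (R : realType) (m : {measure set T -> \bar R}).

Section AnyIntegrand.
Local Open Scope ereal_scope.
Import HBNNSimple.

(** The integral of an arbitrary nonnegative function is the supremum of those of the
    simple functions below it, whence its monotonicity. *)
Lemma ge0_le_integral_any (f g : T -> \bar R) :
  (forall x, 0 <= f x) -> (forall x, f x <= g x) ->
  \int[m]_x f x <= \int[m]_x g x.
Proof.
move=> f0 fg; have g0 x : 0 <= g x by exact: le_trans (fg x).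
rewrite !ge0_integralTE//; apply: ereal_sup_le => _ [h hf <-].
by exists h => // x; exact: le_trans (hf x) (fg x).
Qed.

(** A simple function below [f] has the same integral as its restriction, which lies
    below the restriction of [f]. *)
Lemma ge0_integral_setC_null (N : set T) (f : T -> \bar R) :
  measurable N -> m N = 0 -> (forall x, 0 <= f x) ->
  \int[m]_x f x = \int[m]_x (f \_ (~` N)) x.
Proof.
move=> mN N0 f0; have mCN := measurableC mN.
have fN0 x : 0 <= (f \_ (~` N)) x by rewrite /patch; case: ifP.
apply/eqP; rewrite eq_le; apply/andP; split; last first.
  by apply: ge0_le_integral_any => // x; rewrite /patch; case: ifP.
rewrite [leLHS]ge0_integralTE//; apply: ge_ereal_sup => _ [h hf <-].
have -> : sintegral m h = \int[m]_x (h x)%:E.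
  by rewrite integral_nnsfun// patch_setT.
have h0 x : 0 <= (h x)%:E by rewrite lee_fin; exact: fun_ge0.
rewrite (ge0_negligible_integral mN measurableT _ _ N0)//; last first.
  exact/measurable_EFinP.
rewrite setTD integral_mkcond; apply: ge0_le_integral_any => x.
  by rewrite /patch; case: ifP.
by rewrite /patch; case: ifP => // _; exact: hf.
Qed.

Lemma integral_setC_null (N : set T) (f : T -> \bar R) :
  measurable N -> m N = 0 -> \int[m]_x f x = \int[m]_x (f \_ (~` N)) x.
Proof.
move=> mN N0; rewrite integralE [RHS]integralE.
rewrite (ge0_integral_setC_null mN N0)//.
rewrite [X in _ - X](ge0_integral_setC_null mN N0)//.
by rewrite -funepos_restrict -funeneg_restrict.
Qed.

End AnyIntegrand.

Lemma Rintegral_setC_null (N : set T) (f : T -> R) :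
  measurable N -> m N = 0%E -> \int[m]_x f x = \int[m]_x (f \_ (~` N)) x.
Proof.
move=> mN N0; congr fine; rewrite (integral_setC_null _ mN N0).
by apply: eq_integral => x _; rewrite /patch; case: ifP.
Qed.

(** Measurability for the completion of [m]. *)
Definition nullmeasurable (f : T -> R) : Prop :=
  forall B : set R, measurable B -> completed_algebra_gen m (f @^-1` B).

(** The preimages of the countably many rays with rational end points are
    measurable up to null sets; outside of the union of these null sets the function
    is measurable. The larger set [N'] lets several functions share one null set. *)
Lemma nullmeasurable_modification (f : T -> R) : nullmeasurable f ->
  exists N, [/\ measurable N, m N = 0%E &
    forall N', measurable N' -> N `<=` N' -> measurable_fun setT (f \_ (~` N'))].
Proof.
move=> mf; pose q n : R := ratr (odflt 0 (unpickle n)).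
have /choice[AM AMP] n : exists AM : set T * set T,
    [/\ measurable AM.1, measurable AM.2, m AM.2 = 0%E &
      forall x, ~ AM.2 x -> (q n < f x <-> AM.1 x)].
  have [A mA [N0 [M [mM M0 N0M]] fE]] := mf _ (measurable_itv `]q n, +oo[).
  exists (A, M); split => //= x nMx.
  have -> : (q n < f x) = (f @^-1` `]q n, +oo[%classic) x :> Prop.
    by rewrite /= in_itv/= andbT.
  rewrite -fE; split; last by left.
  by case=> // /N0M.
exists (\bigcup_n (AM n).2); split.
- by apply: bigcupT_measurable => n; have [] := AMP n.
- apply/(negligibleP m); first by apply: bigcupT_measurable => n; have [] := AMP n.
  apply: negligible_bigcup => n; have [_ mM M0 _] := AMP n.
  exact/(negligibleP m mM).
move=> N' mN' NN' _; apply: (measurability _ (RGenOInfty.measurableE R)) => //.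
move=> /= _ [_ [r ->] <-]; rewrite setTI.
rewrite (_ : _ @^-1` _ = \bigcup_(n in [set n | r < q n])
    ((AM n).1 `\` N') `|` (if r < 0 then N' else set0)).
  apply: measurableU; last by case: ifP.
  by apply: bigcup_measurable => n _; apply: measurableD => //; have [] := AMP n.
apply/seteqP; split => x /=; rewrite in_itv/= andbT /patch.
- case: ifPn => [|]; rewrite ?inE ?notin_setE /=.
  + move=> nN'x rfx; left.
    have [p] := rat_in_itvoo rfx; rewrite in_itv/= => /andP[rp pf].
    have qp : q (pickle p) = ratr p by rewrite /q pickleK.
    exists (pickle p); first by rewrite /mkset qp.
    split => //.
    have [_ _ _ <-] := AMP (pickle p); first by rewrite qp.
    by move=> Mx; apply: nN'x; apply: NN'; exists (pickle p).
  + by move=> N'x r0; right; rewrite r0; exact: contrapT.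
- move=> [[n rq [An nN']]|].
  + rewrite mem_set//; apply: lt_trans rq _; have [_ _ _ h] := AMP n.
    by apply/h => // Mx; apply: nN'; apply: NN'; exists n.
  + by case: ifP => // r0 N'x; rewrite memNset//=; exact.
Qed.

Lemma qmodification (f : T -> quat R) :
  (forall c, nullmeasurable (fun x => qcoord c (f x))) ->
  (\int[m]_x (quat_abs (f x))%:E < +oo)%E ->
  exists N, [/\ measurable N, m N = 0%E & qintegrable m (patch (fun=> 0) (~` N) f)].
Proof.
move=> mf foo; have /choice[N NP] c := nullmeasurable_modification (mf c).
pose N' := N QRe `|` N QI `|` N QJ `|` N QK.
have mN c : measurable (N c) by case: (NP c).
have N0 c : m (N c) = 0%E by case: (NP c).
have mN' : measurable N' by rewrite /N'; do 3?[apply: measurableU].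
exists N'; split => //.
  by rewrite /N' !null_set_setU//; do ?[apply: measurableU].
have qcoordE c : (fun x => qcoord c (patch (fun=> 0) (~` N') f x)) =
    (fun x => qcoord c (f x)) \_ (~` N').
  by apply/funext => x; rewrite /patch; case: ifP => // _; rewrite qcoord0.
move=> c; rewrite qcoordE; apply/integrableP; split.
  apply/measurable_EFinP; have [_ _] := NP c; apply => //.
  clear qcoordE; rewrite /N' => x; case: c => Nx;
    [do 3 left|do 2 left; right|left; right|right]; exact: Nx.
apply: le_lt_trans foo; apply: ge0_le_integral_any => // x.
rewrite lee_fin /patch; case: ifP => _; last by rewrite normr0 sqrtr_ge0.
exact: qcoord_le_abs.
Qed.

(** Hence an integral transform of [f] is equal everywhere, and not only almost
    everywhere, to that of a modification of [f] on a null set. *)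
Lemma qint_setC_null (N : set T) (k f : T -> quat R) :
  measurable N -> m N = 0%E ->
  qint m (fun x => k x * f x) = qint m (fun x => k x * patch (fun=> 0) (~` N) f x).
Proof.
move=> mN N0; apply: eq_qcoord => c; rewrite !qcoord_qint.
rewrite (Rintegral_setC_null _ mN N0); apply: eq_Rintegral => x _.
by rewrite /patch; case: ifP => // _; rewrite mulr0 qcoord0.
Qed.

End LebesgueMeasurable.

(** * Locally integrable functions and the Abel factor *)

Section VanishingIntegrals.
Context {R : realType}.
Local Notation mu := (@lebesgue_measure R).

Lemma locally_integrable_itv (f : R -> R) a b : locally_integrable setT f ->
  mu.-integrable `[a, b] (EFin \o f).
Proof.
move=> [mf _ /(_ `[a, b]%classic (@subsetT _ _) (@segment_compact _ _ _)) foo].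
apply/integrableP; split => //.
by apply/measurable_EFinP; exact: measurable_funS mf.
Qed.

(** By Lebesgue differentiation: the primitive based at any $-n$ vanishes, and
    almost everywhere its derivative is [f]. *)
Lemma ae_eq0_itv (f : R -> R) : locally_integrable setT f ->
  (forall a b, a < b -> \int[mu]_(x in `[a, b]) f x = 0) ->
  {ae mu, forall x, f x = 0}.
Proof.
move=> lf f0.
have h n : {ae mu, forall x, - n%:R < x -> f x = 0}.
  have := @FTC1 R f (BLeft (- n%:R))
    (fun=> locally_integrable_itv _ _ lf) lf.
  apply: (@filterS _ _ (ae_filter_ringOfSetsType mu)) => x /= fx nx.
  have [_ <-] := fx nx.
  rewrite derive1E (@near_eq_derive _ R R _ (fun=> 0)) ?derive_cst//.
  near=> y; rewrite f0//; near: y; exact: lt_nbhsr.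
have := ae_foralln h; apply: (@filterS _ _ (ae_filter_ringOfSetsType mu)) => x /= hx.
apply: (hx (Num.truncn `|x|).+1); rewrite ltrNl.
by apply: le_lt_trans (truncnS_gt _); rewrite -normrN ler_norm.
Unshelve. all: by end_near. Qed.

End VanishingIntegrals.

Section AbelKernel.
Context {R : realType}.
Local Notation mu := (@lebesgue_measure R).
Implicit Types c e x y : R.

(** The primitive is the real part of $e^{(c-ix)y}/(c-ix)$; the opposite of its
    imaginary part serves in [is_derive_expR_sin]. *)
Lemma is_derive_expR_cos c x y : c ^+ 2 + x ^+ 2 != 0 ->
  is_derive y 1 (fun y => expR (c * y) * (c * cos (x * y) + x * sin (x * y)) /
    (c ^+ 2 + x ^+ 2)) (expR (c * y) * cos (x * y)).
Proof. by move=> cx; apply: is_derive_eq; rewrite !scaler0 /GRing.scale/=; field. Qed.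

Lemma is_derive_expR_sin c x y : c ^+ 2 + x ^+ 2 != 0 ->
  is_derive y 1 (fun y => expR (c * y) * (c * sin (x * y) - x * cos (x * y)) /
    (c ^+ 2 + x ^+ 2)) (expR (c * y) * sin (x * y)).
Proof. by move=> cx; apply: is_derive_eq; rewrite !scaler0 /GRing.scale/=; field. Qed.

Lemma Rintegral_is_derive (f F : R -> R) a b : a < b -> continuous f ->
  (forall y, is_derive y 1 F (f y)) ->
  \int[mu]_(y in `[a, b]) f y = F b - F a.
Proof.
move=> ab cf dF.
have dFy y : derivable F y 1 by have [] := dF y.
have cF : continuous F.
  by move=> y; apply/differentiable_continuous/derivable1_diffP.
rewrite /Rintegral (@continuous_FTC2 _ f F)//.
- exact: continuous_subspaceT.
- split; [by move=> y _; exact: dFy| |].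
  + by apply/cvg_at_right_filter/cF.
  + by apply/cvg_at_left_filter/cF.
- by move=> y _; rewrite derive1E derive_val.
Qed.

(** [f] is only piecewise smooth, with one primitive on each side of the origin; the
    boundary terms at infinity vanish, and those at the origin remain. *)
Lemma Rintegral_two_sided (f fp fm F G : R -> R) :
  mu.-integrable setT (EFin \o f) -> continuous fp -> continuous fm ->
  (forall y, 0 <= y -> f y = fp y) -> (forall y, y <= 0 -> f y = fm y) ->
  (forall y, is_derive y 1 F (fp y)) -> (forall y, is_derive y 1 G (fm y)) ->
  F n%:R @[n --> \oo] --> 0 -> G (- n%:R) @[n --> \oo] --> 0 ->
  \int[mu]_y f y = G 0 - F 0.
Proof.
move=> fi cfp cfm ffp ffm dF dG F0 G0.
have mf := measurable_fun_EFin_comp fi.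
have fiS (A : set R) : measurable A -> mu.-integrable A (EFin \o f).
  by move=> mA; exact: integrableS fi.
pose u n := \int[mu]_(y in `[- n.+1%:R, n.+1%:R]) f y.
have uE n : u n = (G 0 - G (- n.+1%:R)) + (F n.+1%:R - F 0).
  have n0 : 0 < n.+1%:R :> R by rewrite ltr0n.
  rewrite -(Rintegral_is_derive _ cfp dF)// -(Rintegral_is_derive _ cfm dG) ?oppr_lt0//.
  have := @Rintegral_itvB R f (BLeft (- n.+1%:R)) (BRight n.+1%:R) 0
    (fiS _ (measurable_itv _)).
  rewrite !bnd_simp oppr_le0 (ltW n0) => /(_ isT isT) /eqP.
  rewrite subr_eq /u => /eqP ->; rewrite addrC; congr (_ + _).
    by apply: eq_Rintegral => y; rewrite inE/= in_itv/= => /andP[_ /ffm].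
  rewrite Rintegral_itv_obnd_cbnd; last exact: fiS.
  by apply: eq_Rintegral => y; rewrite inE/= in_itv/= => /andP[/ffp].
have cvu1 : u n @[n --> \oo] --> G 0 - F 0.
  rewrite (_ : G 0 - F 0 = (G 0 - 0) + (0 - F 0)); last by rewrite subr0 sub0r.
  under eq_cvg do rewrite uE.
  apply: cvgD; apply: cvgB; try exact: cvg_cst.
  - by rewrite -(cvg_shiftS (fun n => G (- n%:R))) in G0.
  - by rewrite -(cvg_shiftS (fun n => F n%:R)) in F0.
suff cvu2 : u n @[n --> \oo] --> \int[mu]_y f y.
  exact: cvg_unique cvu2 cvu1.
rewrite /u; under eq_cvg do rewrite Rintegral_mkcond.
apply: (@Rintegral_dominated_cvg _ _ R mu
  (fun n => f \_ `[- n.+1%:R, n.+1%:R]%classic) f (Num.norm \o f)) => //.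
- by move=> n; apply/(measurable_restrict _ _ _).1 => //; exact: measurable_funS mf.
- exact: integrable_norm.
- by move=> n x /=; rewrite /patch; case: ifP => _ //; rewrite normr0.
- apply: aeW => x /=.
  apply: cvg_near_cst; near=> n; rewrite /patch mem_set//= in_itv/= -ler_norml.
  by near: n; exists (Num.truncn `|x|) => // n /= xn; apply/ltW;
    rewrite (lt_le_trans (truncnS_gt _))// ler_nat ltnS.
Unshelve. all: by end_near. Qed.

(** The convergence factor: with it the double integral of the inversion formula
    converges absolutely, so that its two integrations can be exchanged. *)
Definition abel e y : R := expR (- (e * `|y|)).

Lemma abel_ge0 e y : 0 <= abel e y. Proof. exact: expR_ge0. Qed.

Lemma abel_le1 e y : 0 <= e -> abel e y <= 1.
Proof. by move=> e0; rewrite -expR0 ler_expR oppr_le0 mulr_ge0. Qed.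

Lemma continuous_abel e : continuous (abel e).
Proof.
move=> y; apply: continuous_comp; last exact: continuous_expR.
by apply: cvgN; apply: cvgM; [exact: cvg_cst|exact: norm_continuous].
Qed.

Lemma measurable_abel e : measurable_fun setT (abel e).
Proof. by apply: continuous_measurable_fun; exact: continuous_abel. Qed.

Lemma cvgr_expRM e : 0 < e -> expR (- (e * y)) @[y --> +oo] --> 0.
Proof.
move=> e0.
apply: (@cvg_comp _ _ _ (fun n => e * n) (fun y => expR (- y)) _ (pinfty_nbhs R)).
  by have := gt0_cvgMry e0 (@cvg_id _ (pinfty_nbhs R)); exact.
exact: cvgr_expR.
Qed.

Lemma cvgn_expRM e : 0 < e -> expR (- (e * n%:R)) @[n --> \oo] --> 0.
Proof. by move=> e0; exact: cvg_comp (@cvgr_idn R) (cvgr_expRM e0). Qed.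

Lemma integrable_abel e : 0 < e -> mu.-integrable setT (EFin \o abel e).
Proof.
move=> e0; apply/integrableP; split.
  by apply/measurable_EFinP; exact: measurable_abel.
under eq_integral do rewrite /= ger0_norm ?abel_ge0//.
rewrite ge0_symfun_integralT//; first last.
- by move=> x /=; rewrite /abel normrN.
- exact: continuous_abel.
- exact: abel_ge0.
have -> : [set x | 0 <= x] = `[0, +oo[%classic :> set R.
  by apply/seteqP; split => x /=; rewrite in_itv/= andbT.
under eq_integral => x.
  rewrite inE/= in_itv/= andbT => x0; rewrite /abel ger0_norm//; over.
have dF y : is_derive y 1 (fun y => - e^-1 * expR (- (e * y))) (expR (- (e * y))).
  apply: is_derive_eq; rewrite ?scaler0 /GRing.scale/=; field.
  by rewrite gt_eqF.
have cF : continuous (fun y => - e^-1 * expR (- (e * y))).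
  by move=> y; apply/differentiable_continuous/derivable1_diffP; have [] := dF y.
rewrite (@ge0_continuous_FTC2y _ _ (fun y => - e^-1 * expR (- (e * y))) _ 0)//.
- by rewrite -EFinB -EFinM ltry.
- by apply: continuous_subspaceT => y; apply: continuous_comp;
    [apply: cvgN; apply: cvgMr; exact: cvg_id|exact: continuous_expR].
- rewrite -(mulr0 (- e^-1)); apply: cvgMr.
  exact: cvgr_expRM.
- by apply/cvg_at_right_filter/cF.
- by move=> y _; rewrite derive1E derive_val.
Qed.

Lemma continuous_expR_cos c x : continuous (fun y => expR (c * y) * cos (x * y)).
Proof.
move=> y; apply: cvgM; apply: continuous_comp.
- by apply: cvgMr; exact: cvg_id.
- exact: continuous_expR.
- by apply: cvgMr; exact: cvg_id.
- exact: continuous_cos.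
Qed.

Lemma continuous_expR_sin c x : continuous (fun y => expR (c * y) * sin (x * y)).
Proof.
move=> y; apply: cvgM; apply: continuous_comp.
- by apply: cvgMr; exact: cvg_id.
- exact: continuous_expR.
- by apply: cvgMr; exact: cvg_id.
- exact: continuous_sin.
Qed.

End AbelKernel.

(** * The Poisson kernel *)

Section PoissonKernel.
Context {R : realType}.
Local Notation mu := (@lebesgue_measure R).
Implicit Types a b c e k x y : R.

Lemma cvg0_mul_bounded (u v : nat -> R) (M : R) :
  u n @[n --> \oo] --> 0 -> (forall n, `|v n| <= M) ->
  u n * v n @[n --> \oo] --> 0.
Proof.
move=> u0 vM; apply: norm_cvg0.
apply: (@squeeze_cvgr _ _ _ _ (fun=> 0) (fun n => `|u n| * M)).
- by apply: nearW => n; rewrite normr_ge0 normrM ler_wpM2l.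
- exact: cvg_cst.
- rewrite -(mul0r M); apply: cvgMl.
  by rewrite -(normr0 R); apply: cvg_norm.
Qed.

(** The Poisson kernel of the half plane, up to the factor $1/(2\pi)$: the Fourier
    transform of [abel e]. *)
Definition poisson e x : R := 2 * e / (e ^+ 2 + x ^+ 2).

Lemma poisson_denom_gt0 e x : 0 < e -> 0 < e ^+ 2 + x ^+ 2.
Proof. by move=> e0; rewrite ltr_wpDr ?sqr_ge0// exprn_gt0. Qed.

Lemma norm_lin2_le (c x s t D : R) : 0 <= D -> `|s| <= 1 -> `|t| <= 1 ->
  `|(c * s + x * t) / D| <= (`|c| + `|x|) / D.
Proof.
move=> D0 s1 t1; rewrite normrM [X in _ * X]ger0_norm ?invr_ge0//.
rewrite ler_wpM2r ?invr_ge0// (le_trans (ler_normD _ _))// !normrM.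
by rewrite lerD// ler_piMr.
Qed.

Lemma Rintegral_abel_cos e x : 0 < e ->
  \int[mu]_y (abel e y * cos (x * y)) = poisson e x.
Proof.
move=> e0; have d0 := poisson_denom_gt0 x e0.
have ex0 : e ^+ 2 + x ^+ 2 != 0 by rewrite gt_eqF.
have Nex0 : (- e) ^+ 2 + x ^+ 2 != 0 by rewrite sqrrN.
have bnd (c t : R) : c ^+ 2 = e ^+ 2 ->
    `|(c * cos t + x * sin t) / (c ^+ 2 + x ^+ 2)| <=
    (`|c| + `|x|) / (c ^+ 2 + x ^+ 2).
  move=> ->; apply: norm_lin2_le; first exact: ltW.
    exact: cos_max.
  exact: sin_max.
rewrite (@Rintegral_two_sided _ _ _ _ _ _ _ (@continuous_expR_cos R (- e) x)
  (@continuous_expR_cos R e x) _ _ (fun y => is_derive_expR_cos y Nex0)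
  (fun y => is_derive_expR_cos y ex0)).
- by rewrite !mulr0 cos0 sin0 expR0 sqrrN /poisson; field.
- under eq_fun do rewrite mulrC.
  apply: (@integrable_bounded_mul _ _ _ _ _ _ 1).
  + by apply: measurable_cos; exact: measurable_funM.
  + by move=> y; exact: cos_max.
  + exact: integrable_abel.
- by move=> y y0; rewrite /abel ger0_norm// mulNr.
- by move=> y y0; rewrite /abel ler0_norm// mulrN opprK.
- under eq_cvg do rewrite -mulrA mulNr.
  exact: cvg0_mul_bounded (cvgn_expRM e0) (fun n => bnd _ _ (sqrrN e)).
- under eq_cvg do rewrite -mulrA mulrN.
  exact: cvg0_mul_bounded (cvgn_expRM e0) (fun n => bnd _ _ erefl).
Qed.

Lemma Rintegral_abel_sin e x : 0 < e -> \int[mu]_y (abel e y * sin (x * y)) = 0.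
Proof.
move=> e0; have d0 := poisson_denom_gt0 x e0.
have ex0 : e ^+ 2 + x ^+ 2 != 0 by rewrite gt_eqF.
have Nex0 : (- e) ^+ 2 + x ^+ 2 != 0 by rewrite sqrrN.
have bnd (c t : R) : c ^+ 2 = e ^+ 2 ->
    `|(c * sin t - x * cos t) / (c ^+ 2 + x ^+ 2)| <=
    (`|c| + `|- x|) / (c ^+ 2 + x ^+ 2).
  move=> ->; rewrite -mulNr; apply: norm_lin2_le; first exact: ltW.
    exact: sin_max.
  exact: cos_max.
rewrite (@Rintegral_two_sided _ _ _ _ _ _ _ (@continuous_expR_sin R (- e) x)
  (@continuous_expR_sin R e x) _ _ (fun y => is_derive_expR_sin y Nex0)
  (fun y => is_derive_expR_sin y ex0)).
- by rewrite !mulr0 cos0 sin0 expR0 sqrrN; field.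
- under eq_fun do rewrite mulrC.
  apply: (@integrable_bounded_mul _ _ _ _ _ _ 1).
  + by apply: measurable_sin; exact: measurable_funM.
  + by move=> y; exact: sin_max.
  + exact: integrable_abel.
- by move=> y y0; rewrite /abel ger0_norm// mulNr.
- by move=> y y0; rewrite /abel ler0_norm// mulrN opprK.
- under eq_cvg do rewrite -mulrA mulNr.
  exact: cvg0_mul_bounded (cvgn_expRM e0) (fun n => bnd _ _ (sqrrN e)).
- under eq_cvg do rewrite -mulrA mulrN.
  exact: cvg0_mul_bounded (cvgn_expRM e0) (fun n => bnd _ _ erefl).
Qed.

Lemma norm_poisson_le e x : 0 < e -> `|poisson e x| <= 2 / e.
Proof.
move=> e0; have d0 := poisson_denom_gt0 x e0.
rewrite ger0_norm; last by rewrite /poisson divr_ge0 ?mulr_ge0 ?ltW.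
rewrite /poisson ler_pdivrMr// mulrAC ler_pdivlMr// mulrDr -mulrA -expr2.
by rewrite lerDl mulr_ge0// sqr_ge0.
Qed.

Lemma continuous_poisson e : 0 < e -> continuous (poisson e).
Proof.
move=> e0 x; apply: cvgM; first exact: cvg_cst.
apply: cvgV; first by rewrite gt_eqF// poisson_denom_gt0.
by apply: cvgD; [exact: cvg_cst|exact: exprn_continuous].
Qed.

Lemma Rintegral_poisson e k y a b : 0 < e -> 0 < k -> a < b ->
  \int[mu]_(x in `[a, b]) poisson e (k * (x - y)) =
  2 / k * (atan (k * (b - y) / e) - atan (k * (a - y) / e)).
Proof.
move=> e0 k0 ab.
have cf : continuous (fun x => poisson e (k * (x - y))).
  move=> x; apply: (@continuous_comp _ _ _ (fun x => k * (x - y)) (poisson e));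
    last exact: continuous_poisson.
  by apply: cvgMr; apply: cvgB; [exact: cvg_id|exact: cvg_cst].
have dF x : is_derive x 1 (fun x => 2 / k * atan (k * (x - y) / e))
    (poisson e (k * (x - y))).
  apply: is_derive_eq; rewrite ?scaler0 /GRing.scale/= /poisson.
  have h := poisson_denom_gt0 (k * (x - y)) e0.
  by field; rewrite !gt_eqF.
by rewrite (Rintegral_is_derive ab cf dF) -mulrBr.
Qed.

(** Rescaled arctangents tend to signs, so the difference of two of them tends to a
    multiple of the indicator function of an interval. *)
Lemma cvg_atan_natM (t : R) :
  atan (t * n.+1%:R) @[n --> \oo] --> pi / 2 * Num.sg t.
Proof.
have pos (s : R) : 0 < s -> atan (s * n.+1%:R) @[n --> \oo] --> (pi / 2 : R).
  move=> s0.
  have h : atan (s * z) @[z --> +oo] --> (pi / 2 : R).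
    apply: (@cvg_comp _ _ _ (fun z => s * z) atan _ (pinfty_nbhs R)).
      by have := gt0_cvgMry s0 (@cvg_id _ (pinfty_nbhs R)); exact.
    exact: cvgy_atan.
  rewrite (cvg_shiftS (fun n => atan (s * n%:R))).
  exact: cvg_comp (@cvgr_idn R) h.
have [t0|t0|->] := ltrgt0P t.
- by rewrite gtr0_sg// mulr1; exact: pos.
- rewrite ltr0_sg// mulrN1.
  rewrite (_ : (fun n => _) = (fun n : nat => - atan (- t * n.+1%:R))).
    by apply: cvgN; apply: pos; rewrite oppr_gt0.
  by apply/funext => n; rewrite mulNr atanN opprK.
- by rewrite sgr0 mulr0; under eq_cvg do rewrite mul0r atan0; exact: cvg_cst.
Qed.

End PoissonKernel.

(** * Fourier inversion on the line *)

Section FourierInversion.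
Context {R : realType}.
Local Notation mu := (@lebesgue_measure R).
Variables (nu : quat R) (k : R).
Hypotheses (nu2 : nu * nu = -1) (k_gt0 : 0 < k).
Implicit Types (g : R -> quat R) (c : quat_index).

Lemma norm_qcoord_expiM_le c th q :
  `|qcoord c (quat_expi nu th * q)| <= `|qcoord c q| + `|qcoord c (nu * q)|.
Proof.
rewrite quat_expiM qcoordD !qcoordZ (le_trans (ler_normD _ _))// !normrM.
by rewrite lerD// ler_piMl// ?cos_max ?sin_max.
Qed.

(** Regularized inversion. After exchanging the integrals, the two exponentials
    combine and the inner integral is the Poisson kernel: the sine part, which alone
    carries the non-central factor [nu], vanishes by parity. *)
Lemma abel_fourier g e x : 0 < e -> qintegrable mu g ->
  qint mu (fun w => abel e w *: (quat_expi nu (k * x * w) *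
    qint mu (fun y => quat_expi nu (- (k * y * w)) * g y))) =
  qint mu (fun y => poisson e (k * (x - y)) *: g y).
Proof.
move=> e0 gi.
pose E (z : R * R) := abel e z.1 *: (quat_expi nu (k * (x - z.2) * z.1) * g z.2).
have mth : measurable_fun setT (fun z : R * R => k * (x - z.2) * z.1).
  apply: measurable_funM => //; apply: measurable_funM => //.
  exact: measurable_funB.
have Ei : qintegrable (mu \x mu)%E E.
  have : qintegrable (mu \x mu)%E (fun z => quat_expi nu (k * (x - z.2) * z.1) *
      (abel e z.1 *: g z.2)).
    apply: qintegrable_expi => // c; under eq_fun do rewrite qcoordZ.
    exact: (integrable_tensor (integrable_abel e0) (gi c)).
  by congr qintegrable; apply/funext => z; rewrite -scalerAr.
transitivity (qint mu (fun w => qint mu (fun y => E (w, y)))).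
  apply: eq_qint => w.
  have gi1 : qintegrable mu (fun y => quat_expi nu (- (k * y * w)) * g y).
    apply: qintegrable_expi => //; apply: measurableT_comp => //.
    by apply: measurable_funM => //; exact: measurable_funM.
  rewrite -qint_mull// -qintZ; last exact: qintegrable_mull.
  apply: eq_qint => y; rewrite /E /= mulrA -quat_expiD//.
  by have -> : k * x * w - k * y * w = k * (x - y) * w by ring.
rewrite -(qint12 Ei) (qint21 Ei); apply: eq_qint => y; rewrite /E /=.
rewrite qint_expi_scale; [|by apply: measurable_funM|exact: integrable_abel].
by rewrite Rintegral_abel_cos// Rintegral_abel_sin// scale0r addr0.
Qed.

Lemma Rintegral_indic_mul (D : set R) (f : R -> R) :
  \int[mu]_(x in D) f x = \int[mu]_x (\1_D x * f x).
Proof.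
rewrite Rintegral_mkcond; apply: eq_Rintegral => x _.
by rewrite /patch indicE; case: ifP; rewrite ?mul1r ?mul0r.
Qed.

(** Integrating the Poisson means of [f] over an interval amounts to integrating [f]
    against a smoothed indicator function of that interval. *)
Lemma Rintegral_poisson_conv (f : R -> R) e a b : 0 < e -> a < b ->
  mu.-integrable setT (EFin \o f) ->
  \int[mu]_(x in `[a, b]) \int[mu]_y (poisson e (k * (x - y)) * f y) =
  \int[mu]_y (2 / k * (atan (k * (b - y) / e) - atan (k * (a - y) / e)) * f y).
Proof.
move=> e0 ab fi.
pose E (z : R * R) := poisson e (k * (z.1 - z.2)) * (\1_`[a, b]%classic z.1 * f z.2).
have mp : measurable_fun setT (fun z : R * R => poisson e (k * (z.1 - z.2))).
  apply: measurableT_comp.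
    by apply: continuous_measurable_fun; exact: continuous_poisson.
  by apply: measurable_funM => //; exact: measurable_funB.
have Ei : (mu \x mu)%E.-integrable setT (EFin \o E).
  apply: (@integrable_bounded_mul _ _ _ _ _ _ (2 / e)) => //.
    by move=> z; exact: norm_poisson_le.
  exact: (integrable_tensor (integrable_indic_itv a b true false) fi).
have fpi x : mu.-integrable setT (EFin \o (fun y => poisson e (k * (x - y)) * f y)).
  apply: (@integrable_bounded_mul _ _ _ _ _ _ (2 / e)) => //.
    exact: measurableT_comp mp (pair1_measurable x).
  by move=> y; exact: norm_poisson_le.
transitivity (\int[mu]_x \int[mu]_y E (x, y)).
  rewrite Rintegral_indic_mul; apply: eq_Rintegral => x _.
  rewrite -RintegralZl//; apply: eq_Rintegral => y _.
  by rewrite /E /= mulrCA.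
rewrite -(Rintegral12 Ei) (Rintegral_swap Ei) (Rintegral12 (integrable_swap Ei)).
apply: eq_Rintegral => y _ /=.
rewrite -Rintegral_poisson// Rintegral_indic_mul -RintegralZr//.
  by apply: eq_Rintegral => x _; rewrite /E /= mulrA [_ * \1__ _]mulrC.
rewrite (_ : _ \o _ = EFin \o (fun x => poisson e (k * (x - y)) *
    \1_`[a, b]%classic x)); last by apply/funext => x /=; rewrite mulrC.
apply: (@integrable_bounded_mul _ _ _ _ _ _ (2 / e)) => //.
- exact: measurableT_comp mp (pair2_measurable y).
- by move=> x; exact: norm_poisson_le.
- exact: (integrable_indic_itv a b true false).
Qed.

Lemma ae_neq (a : R) : {ae mu, forall x, x <> a}.
Proof.
exists [set a]; split; [exact: measurable_set1|exact: lebesgue_measure_set1|].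
by move=> x /= /contrapT.
Qed.

Definition abel_seq n : R := n.+1%:R^-1.

Lemma abel_seq_gt0 n : 0 < abel_seq n.
Proof. by rewrite /abel_seq invr_gt0 ltr0n. Qed.

Lemma cvg_abel_seq w : abel (abel_seq n) w @[n --> \oo] --> (1 : R).
Proof.
rewrite -expR0; apply: continuous_cvg; first exact: continuous_expR.
rewrite -oppr0; apply: cvgN; rewrite -(mul0r `|w|); apply: cvgMl.
exact: cvg_harmonic.
Qed.

(** The smoothed indicator functions are uniformly bounded and converge except at the
    end points, so dominated convergence applies to every integrable [f]. *)
Lemma cvg_poisson_conv (f : R -> R) a b : a < b ->
  mu.-integrable setT (EFin \o f) ->
  \int[mu]_y (2 / k * (atan (k * (b - y) / abel_seq n) -
    atan (k * (a - y) / abel_seq n)) * f y) @[n --> \oo] -->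
  2 * pi / k * \int[mu]_(y in `[a, b]) f y.
Proof.
move=> ab fi; have mf := measurable_fun_EFin_comp fi.
have k0 : k != 0 by rewrite gt_eqF.
pose h n y := 2 / k * (atan (k * (b - y) / abel_seq n) -
    atan (k * (a - y) / abel_seq n)).
have mh n : measurable_fun setT (h n).
  apply: measurable_funM => //; apply: measurable_funB.
    apply: measurableT_comp.
      by apply: continuous_measurable_fun; exact: continuous_atan.
    apply: measurable_funM => //; apply: measurable_funM => //.
    exact: measurable_funB.
  apply: measurableT_comp.
    by apply: continuous_measurable_fun; exact: continuous_atan.
  apply: measurable_funM => //; apply: measurable_funM => //.
  exact: measurable_funB.
have h_le n y : `|h n y| <= 2 * pi / k.
  have := atan_ltpi2 (k * (b - y) / abel_seq n).
  have := atan_gtNpi2 (k * (b - y) / abel_seq n).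
  have := atan_ltpi2 (k * (a - y) / abel_seq n).
  have := atan_gtNpi2 (k * (a - y) / abel_seq n).
  rewrite /h; set A := atan _; set B := atan _ => h1 h2 h3 h4.
  have k2 : 0 <= 2 / k by rewrite divr_ge0// ltW.
  rewrite normrM (ger0_norm k2) (mulrAC 2 pi) ler_wpM2l//.
  by rewrite ler_norml; apply/andP; split; lra.
have ind_le y : `|\1_`[a, b]%classic y : R| <= 1.
  by rewrite indicE; case: (_ \in _); rewrite ?normr1 ?normr0.
have mind : measurable_fun setT (\1_`[a, b]%classic : R -> R) by [].
have indi : mu.-integrable setT (EFin \o (fun y => \1_`[a, b]%classic y * f y)).
  by apply: (@integrable_bounded_mul _ _ R mu \1_`[a, b]%classic f 1).
rewrite Rintegral_indic_mul -RintegralZl//.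
apply: (@Rintegral_dominated_cvg _ _ R mu (fun n y => h n y * f y)
  (fun y => 2 * pi / k * (\1_`[a, b]%classic y * f y))
  (fun y => 2 * pi / k * `|f y|)).
- by move=> n; exact: (measurable_funM (mh n) mf).
- by apply: measurable_funM => //; exact: (measurable_funM mind mf).
- apply: (@integrable_bounded_mul _ _ _ _ _ _ `|2 * pi / k|) => //.
  exact: integrable_norm.
- by move=> n y; rewrite normrM ler_wpM2r.
have : {ae mu, forall y, y <> a /\ y <> b}.
  exact: (@filterI _ _ (ae_filter_ringOfSetsType mu) _ _ (ae_neq a) (ae_neq b)).
apply: (@filterS _ _ (ae_filter_ringOfSetsType mu)) => y /= [ya yb].
rewrite mulrA; apply: cvgMl.
have -> : 2 * pi / k * \1_`[a, b]%classic y =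
    2 / k * (pi / 2 * Num.sg (k * (b - y)) - pi / 2 * Num.sg (k * (a - y))).
  rewrite !sgrM gtr0_sg// !mul1r indicE /=.
  have [ay|ya'|/esym//] := ltgtP a y.
  - rewrite [Num.sg (a - y)]ltr0_sg ?subr_lt0//.
    have [by_|yb'|/esym//] := ltgtP b y.
    + rewrite ltr0_sg ?subr_lt0// memNset/=; first by rewrite mulr0n; field.
      by rewrite in_itv/= => /andP[_]; rewrite leNgt by_.
    + rewrite gtr0_sg ?subr_gt0// mem_set/=; first by rewrite mulr1n; field.
      by rewrite in_itv/= !ltW.
  - have yb' := lt_trans ya' ab.
    rewrite (@gtr0_sg _ (b - y)) ?subr_gt0//.
    rewrite (@gtr0_sg _ (a - y)) ?subr_gt0//.
    rewrite memNset/=; first by rewrite mulr0n; field.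
    by rewrite in_itv/= => /andP[]; rewrite leNgt ya'.
apply: cvgMr; apply: cvgB.
- by under eq_cvg do rewrite /abel_seq invrK; exact: cvg_atan_natM.
- by under eq_cvg do rewrite /abel_seq invrK; exact: cvg_atan_natM.
Qed.

(** Both sides are limits of the integrals over $[a,b]$ of the regularized inversion
    formula: the left one because the regularization is dominated by the integrable
    [ghat], the right one by [cvg_poisson_conv]. *)
Lemma fourier_inversion_itv g c a b : a < b -> qintegrable mu g ->
  let ghat w := qint mu (fun y => quat_expi nu (- (k * y * w)) * g y) in
  qintegrable mu ghat ->
  \int[mu]_(x in `[a, b])
    qcoord c (qint mu (fun w => quat_expi nu (k * x * w) * ghat w)) =
  2 * pi / k * \int[mu]_(x in `[a, b]) qcoord c (g x).
Proof.
move=> ab gi ghat ghati.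
pose E (z : R * R) := quat_expi nu (k * z.1 * z.2) * ghat z.2.
have mghat2 : qmeasurable (fun z : R * R => ghat z.2).
  move=> c'.
  exact: measurableT_comp (qintegrable_measurable ghati c') measurable_snd.
have mph : measurable_fun setT (fun z : R * R => k * z.1 * z.2).
  have h1 : measurable_fun setT (fun z : R * R => k * z.1) by apply: measurable_funM.
  exact: (measurable_funM h1 measurable_snd).
have mE : qmeasurable E by exact: (qmeasurable_expi _ mph mghat2).
have Ei x : qintegrable mu (fun w => E (x, w)).
  apply: qintegrable_expi => //.
  exact: measurableT_comp mph (pair1_measurable x).
pose S n x := qint mu (fun w => abel (abel_seq n) w *: E (x, w)).
pose H w := `|qcoord c (ghat w)| + `|qcoord c (nu * ghat w)|.
have Hi : mu.-integrable setT (EFin \o H).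
  apply: integrable_addr; apply: integrable_norm; first exact: ghati.
  exact: qintegrable_mull.
have EH x w : `|qcoord c (E (x, w))| <= H w by exact: norm_qcoord_expiM_le.
have abE_le n x w : `|abel (abel_seq n) w * qcoord c (E (x, w))| <= H w.
  rewrite normrM ger0_norm ?abel_ge0// (le_trans _ (EH x w))// ler_piMl//.
  by rewrite abel_le1// ltW// abel_seq_gt0.
have mabE n : qmeasurable (fun z : R * R => abel (abel_seq n) z.2 *: E z).
  apply: qmeasurableZ => //.
  exact: measurableT_comp (measurable_abel _) measurable_snd.
have mS n : qmeasurable (S n) by exact: (qmeasurable_qint mu (mabE n)).
have S_le n x : `|qcoord c (S n x)| <= \int[mu]_w H w.
  rewrite /S qcoord_qint; under eq_Rintegral do rewrite qcoordZ.
  have abEi : mu.-integrable setT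
      (EFin \o (fun w => abel (abel_seq n) w * qcoord c (E (x, w)))).
    apply: (le_integrable measurableT _ _ Hi).
      apply/measurable_EFinP; apply: measurable_funM; first exact: measurable_abel.
      exact: (qintegrable_measurable (Ei x) c).
    move=> w _ /=; rewrite lee_fin.
    by rewrite (le_trans (abE_le n x w))// ler_norm.
  apply: le_trans (le_normr_Rintegral measurableT abEi) _.
  by apply: le_Rintegral => //; exact: integrable_norm.
have cvgS x : qcoord c (S n x) @[n --> \oo] --> qcoord c (qint mu (fun w => E (x, w))).
  rewrite /S qcoord_qint.
  rewrite (_ : (fun n => _) = (fun n => \int[mu]_w
      (abel (abel_seq n) w * qcoord c (E (x, w))))); last first.
    apply/funext => n; rewrite qcoord_qint.
    by under eq_Rintegral do rewrite qcoordZ.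
  apply: (@Rintegral_dominated_cvg _ _ R mu
    (fun n w => abel (abel_seq n) w * qcoord c (E (x, w)))
    (fun w => qcoord c (E (x, w))) H) => //.
  - move=> n; apply: measurable_funM; first exact: measurable_abel.
    exact: (qintegrable_measurable (Ei x) c).
  - exact: (qintegrable_measurable (Ei x) c).
  - apply: aeW => w; rewrite -[X in _ --> X]mul1r.
    by apply: cvgMl; exact: cvg_abel_seq.
have cvg1 : \int[mu]_(x in `[a, b]) qcoord c (S n x) @[n --> \oo] -->
    \int[mu]_(x in `[a, b]) qcoord c (qint mu (fun w => E (x, w))).
  under eq_cvg do rewrite Rintegral_indic_mul.
  rewrite Rintegral_indic_mul.
  have mind : measurable_fun setT (\1_`[a, b]%classic : R -> R) by [].
  apply: (@Rintegral_dominated_cvg _ _ R mu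
    (fun n x => \1_`[a, b]%classic x * qcoord c (S n x))
    (fun x => \1_`[a, b]%classic x * qcoord c (qint mu (fun w => E (x, w))))
    (fun x => \int[mu]_w H w * \1_`[a, b]%classic x)).
  - by move=> n; exact: (measurable_funM mind (mS n c)).
  - apply: (measurable_funM mind).
    exact: (qmeasurable_qint mu mE c).
  - exact: integrableZl (integrable_indic_itv a b true false).
  - move=> n x; rewrite normrM mulrC.
    rewrite (@ger0_norm _ (\1_`[a, b]%classic x)) ?indicE ?ler0n//.
    by rewrite ler_wpM2r// ler0n.
  - by apply: aeW => x; apply: cvgMr; exact: cvgS.
have SE n x : S n x = qint mu (fun y => poisson (abel_seq n) (k * (x - y)) *: g y).
  by rewrite -abel_fourier//; exact: abel_seq_gt0.
have cvg2 := cvg_poisson_conv ab (gi c).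
apply: (cvg_unique _ cvg1) => //.
rewrite (_ : (fun n => _) = (fun n => \int[mu]_y (2 / k *
    (atan (k * (b - y) / abel_seq n) - atan (k * (a - y) / abel_seq n)) *
    qcoord c (g y)))) //.
apply/funext => n; rewrite -(Rintegral_poisson_conv (abel_seq_gt0 n) ab (gi c)).
apply: eq_Rintegral => x _; rewrite SE qcoord_qint.
by apply: eq_Rintegral => y _; rewrite qcoordZ.
Qed.

(** The inversion integral is bounded, hence locally integrable, so its integrals
    over intervals determine it almost everywhere. *)
Lemma fourier_inversion g : qintegrable mu g ->
  let ghat w := qint mu (fun y => quat_expi nu (- (k * y * w)) * g y) in
  qintegrable mu ghat ->
  {ae mu, forall x, qint mu (fun w => quat_expi nu (k * x * w) * ghat w) =
    (2 * pi / k) *: g x}.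
Proof.
move=> gi ghat ghati.
pose G x := qint mu (fun w => quat_expi nu (k * x * w) * ghat w).
have mG : qmeasurable G.
  apply: (qmeasurable_qint mu
    (f := fun z : R * R => quat_expi nu (k * z.1 * z.2) * ghat z.2)).
  apply: qmeasurable_expi.
    apply: measurable_funM; last exact: measurable_snd.
    by apply: measurable_funM.
  move=> c.
  exact: measurableT_comp (qintegrable_measurable ghati c) measurable_snd.
have lG c : locally_integrable setT (fun x => qcoord c (G x)).
  split; [exact: mG|exact: openT|move=> K _ cK].
  have : mu.-integrable K (EFin \o (fun x => qcoord c (G x))).
    apply: measurable_bounded_integrable.
    - exact: compact_measurable.
    - exact: compact_finite_measure.
    - exact: measurable_funS (mG c).
    - exists (\int[mu]_w (`|qcoord c (ghat w)| + `|qcoord c (nu * ghat w)|)).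
      split => [|M MG x _ /=]; first exact: num_real.
      apply: le_trans (ltW MG).
      rewrite /G qcoord_qint.
      have Ei : qintegrable mu (fun w => quat_expi nu (k * x * w) * ghat w).
        by apply: qintegrable_expi.
      apply: le_trans (le_normr_Rintegral measurableT (Ei c)) _.
      apply: le_Rintegral => //.
      + exact: integrable_norm (Ei c).
      + apply: integrable_addr; apply: integrable_norm; first exact: ghati.
        exact: qintegrable_mull.
      + by move=> w _; exact: norm_qcoord_expiM_le.
  by case/integrableP.
have lg c : locally_integrable setT (fun x => 2 * pi / k * qcoord c (g x)).
  apply: open_integrable_locally; first exact: openT.
  exact: integrableZl (gi c).
have h c : {ae mu, forall x, qcoord c (G x) - 2 * pi / k * qcoord c (g x) = 0}.
  apply: ae_eq0_itv; first exact: locally_integrableB (lG c) (lg c).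
  move=> a b ab.
  rewrite (RintegralB _ (locally_integrable_itv _ _ (lG c))
    (locally_integrable_itv _ _ (lg c)))//.
  rewrite fourier_inversion_itv// RintegralZl ?subrr//.
  by apply: integrableS (gi c).
apply: ae_eq_qcoord => c; have := h c.
apply: (@filterS _ _ (ae_filter_ringOfSetsType mu)) => x /= hx.
by rewrite qcoordZ; apply/eqP; rewrite -subr_eq0; apply/eqP.
Qed.

End FourierInversion.

(** * Oscillating kernels on the line and on the plane *)

(** The common shape of all the kernels, acting on the left: a real normalization and
    an exponential of some phase. *)
Definition osc (R : realType) (nu : quat R) (kap th : R) (q : quat R) : quat R :=
  kap *: (quat_expi nu th * q).

Section Oscillation.
Context d (T : measurableType d) (R : realType) (m : {measure set T -> \bar R}).
Variables (nu : quat R) (kap : R).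
Implicit Types (f : T -> quat R) (th : T -> R).

Lemma qmeasurable_osc th f : measurable_fun setT th -> qmeasurable f ->
  qmeasurable (fun x => osc nu kap (th x) (f x)).
Proof.
move=> mth mf; apply: (@qmeasurableZ _ _ _ (fun=> kap)) => //.
exact: qmeasurable_expi.
Qed.

Lemma qintegrable_osc th f : measurable_fun setT th -> qintegrable m f ->
  qintegrable m (fun x => osc nu kap (th x) (f x)).
Proof. by move=> mth fi; apply: qintegrableZ; exact: qintegrable_expi. Qed.

Lemma qint_osc (t : R) f : qintegrable m f ->
  qint m (fun x => osc nu kap t (f x)) = osc nu kap t (qint m f).
Proof.
by move=> fi; rewrite /osc -qint_mull// -qintZ//; exact: qintegrable_mull.
Qed.

End Oscillation.

Section ChirpInversion.
Context {R : realType}.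
Local Notation mu := (@lebesgue_measure R).
Variables (nu : quat R) (kap k : R) (p r : R -> R).
Hypotheses (nu2 : nu * nu = -1) (k_gt0 : 0 < k) (kap2 : kap ^+ 2 = k / (2 * pi)).
Hypotheses (mp : measurable_fun setT p) (mr : measurable_fun setT r).

(** The factor [p x] of the phase is absorbed in [g] and the factor [r y] in its
    transform; as all exponentials involved commute, what remains is the Fourier
    transform. The condition on [kap] normalizes the constant. *)
Lemma chirp_inversion (g : R -> quat R) : qintegrable mu g ->
  let h y := qint mu (fun x => osc nu kap (p x - k * x * y + r y) (g x)) in
  qintegrable mu h ->
  {ae mu, forall x,
    qint mu (fun y => osc nu kap (- (p x - k * x * y + r y)) (h y)) = g x}.
Proof.
move=> gi h hi.
have pi0 : 0 < pi :> R := pi_gt0 R.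
have kap0 : kap != 0.
  by rewrite -sqrf_eq0 kap2 gt_eqF// divr_gt0// mulr_gt0.
pose g1 x := quat_expi nu (p x) * g x.
have g1i : qintegrable mu g1 by exact: qintegrable_expi.
pose ghat y := qint mu (fun x => quat_expi nu (- (k * x * y)) * g1 x).
have hE y : h y = kap *: (quat_expi nu (r y) * ghat y).
  have e1i : qintegrable mu (fun x => quat_expi nu (- (k * x * y)) * g1 x).
    apply: qintegrable_expi => //; apply: measurableT_comp => //.
    by apply: measurable_funM => //; exact: measurable_funM.
  rewrite /h /ghat -qint_mull// -qintZ; last exact: qintegrable_mull.
  apply: eq_qint => x; rewrite /osc /g1 !mulrA -!quat_expiD//.
  by have -> : p x - k * x * y + r y = r y - k * x * y + p x by ring.
have ghatE y : ghat y = kap^-1 *: (quat_expi nu (- r y) * h y).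
  rewrite hE -scalerAr scalerA mulVf// scale1r.
  by rewrite quat_expiNK.
have ghati : qintegrable mu ghat.
  rewrite (_ : ghat = (fun y => kap^-1 *: (quat_expi nu (- r y) * h y))).
    apply: qintegrableZ; apply: qintegrable_expi => //.
    exact: measurableT_comp.
  exact/funext.
have := fourier_inversion nu2 k_gt0 g1i ghati.
apply: (@filterS _ _ (ae_filter_ringOfSetsType mu)) => x /= hx.
have e2i : qintegrable mu (fun y => quat_expi nu (k * x * y) * ghat y).
  by apply: qintegrable_expi => //; exact: measurable_funM.
transitivity (kap ^+ 2 *: (quat_expi nu (- p x) *
    qint mu (fun y => quat_expi nu (k * x * y) * ghat y))).
  rewrite -qint_mull// -qintZ; last exact: qintegrable_mull.
  apply: eq_qint => y; rewrite /osc hE -scalerAr scalerA -expr2; congr (_ *: _).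
  rewrite !mulrA -!quat_expiD//.
  by have -> : - (p x - k * x * y + r y) + r y = - p x + k * x * y by ring.
rewrite hx -scalerAr scalerA quat_expiNK//.
have tK (t : R) : 0 < t -> k / (2 * t) * (2 * t / k) = 1.
  by move=> t0; field; rewrite !gt_eqF.
by rewrite kap2 tK// scale1r.
Qed.

End ChirpInversion.

Section PlaneInversion.
Context {R : realType}.
Local Notation mu := (@lebesgue_measure R).
Local Notation mu2 := (mu \x mu)%E.
Variables (nu1 nu2 : quat R) (kap1 kap2 : R) (th1 th2 : R -> R -> R).
Hypotheses (mth1 : measurable_fun setT (fun z : R * R => th1 z.1 z.2))
  (mth2 : measurable_fun setT (fun z : R * R => th2 z.1 z.2)).
(* Each kernel enters only through its inversion formula on the line: this is what makes
   the argument insensitive to the noncommutation of [nu1] and [nu2]. *)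
Hypothesis inv1 : forall g : R -> quat R, qintegrable mu g ->
  let h y := qint mu (fun x => osc nu1 kap1 (th1 x y) (g x)) in
  qintegrable mu h ->
  {ae mu, forall x, qint mu (fun y => osc nu1 kap1 (- th1 x y) (h y)) = g x}.
Hypothesis inv2 : forall g : R -> quat R, qintegrable mu g ->
  let h y := qint mu (fun x => osc nu2 kap2 (th2 x y) (g x)) in
  qintegrable mu h ->
  {ae mu, forall x, qint mu (fun y => osc nu2 kap2 (- th2 x y) (h y)) = g x}.

Let mth1_comp d (T : measurableType d) (a b : T -> R) :
  measurable_fun setT a -> measurable_fun setT b ->
  measurable_fun setT (fun x => th1 (a x) (b x)).
Proof.
by move=> ma mb; exact: measurableT_comp mth1 (measurable_fun_pair ma mb).
Qed.

Let mth2_comp d (T : measurableType d) (a b : T -> R) :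
  measurable_fun setT a -> measurable_fun setT b ->
  measurable_fun setT (fun x => th2 (a x) (b x)).
Proof.
by move=> ma mb; exact: measurableT_comp mth2 (measurable_fun_pair ma mb).
Qed.

Lemma qmeasurable_plane_transform (f : R * R -> quat R) : qintegrable mu2 f ->
  qmeasurable (fun w => qint mu2 (fun z => osc nu1 kap1 (th1 z.1 w.1)
    (osc nu2 kap2 (th2 z.2 w.2) (f z)))).
Proof.
move=> fi; have mf := qintegrable_measurable fi.
rewrite (_ : (fun w => _) = (fun w => qint mu (fun s => qint mu (fun t =>
    osc nu1 kap1 (th1 s w.1) (osc nu2 kap2 (th2 t w.2) (f (s, t))))))); last first.
  apply/funext => w.
  have K12i : qintegrable mu2 (fun z => osc nu1 kap1 (th1 z.1 w.1)
      (osc nu2 kap2 (th2 z.2 w.2) (f z))).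
    apply: qintegrable_osc; first by apply: mth1_comp; [exact: measurable_fst|].
    by apply: qintegrable_osc => //; apply: mth2_comp; [exact: measurable_snd|].
  by rewrite (qint12 K12i).
apply: (qmeasurable_qint mu (f := fun z : (R * R) * R => qint mu (fun t =>
    osc nu1 kap1 (th1 z.2 z.1.1) (osc nu2 kap2 (th2 t z.1.2) (f (z.2, t)))))).
apply: (qmeasurable_qint mu (f := fun z : ((R * R) * R) * R =>
    osc nu1 kap1 (th1 z.1.2 z.1.1.1)
      (osc nu2 kap2 (th2 z.2 z.1.1.2) (f (z.1.2, z.2))))).
have m11 : measurable_fun setT (fun z : ((R * R) * R) * R => z.1.1).
  exact: measurableT_comp measurable_fst measurable_fst.
have m12 : measurable_fun setT (fun z : ((R * R) * R) * R => z.1.2).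
  exact: measurableT_comp measurable_snd measurable_fst.
apply: qmeasurable_osc.
  by apply: mth1_comp m12 _; exact: measurableT_comp measurable_fst m11.
apply: qmeasurable_osc.
  by apply: mth2_comp measurable_snd _; exact: measurableT_comp measurable_snd m11.
move=> c; apply: measurableT_comp (mf c) _.
exact: measurable_fun_pair m12 measurable_snd.
Qed.

(** The transform [h] in the second variable alone is an intermediate step: [F] is its
    transform in the first variable. Inverting in the first variable recovers [h] from
    almost every section of [F], then inverting in the second variable recovers [f]
    from almost every section of [h]. In the inversion formula the kernel undone first
    is the innermost one, so the kernels never have to be commuted. *)
Lemma plane_inversion (f : R * R -> quat R) : qintegrable mu2 f ->
  let F w := qint mu2 (fun z => osc nu1 kap1 (th1 z.1 w.1)
    (osc nu2 kap2 (th2 z.2 w.2) (f z))) in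
  qintegrable mu2 F ->
  {ae mu2, forall z, f z = qint mu2 (fun w => osc nu2 kap2 (- th2 z.2 w.2)
    (osc nu1 kap1 (- th1 z.1 w.1) (F w)))}.
Proof.
move=> fi F Fi; have mf := qintegrable_measurable fi.
have mF := qintegrable_measurable Fi.
pose h s v := qint mu (fun t => osc nu2 kap2 (th2 t v) (f (s, t))).
have mh : qmeasurable (fun z : R * R => h z.1 z.2).
  apply: (qmeasurable_qint mu (f := fun z : (R * R) * R =>
    osc nu2 kap2 (th2 z.2 z.1.2) (f (z.1.1, z.2)))).
  apply: qmeasurable_osc.
    apply: mth2_comp; first exact: measurable_snd.
    exact: measurableT_comp measurable_snd measurable_fst.
  move=> c; apply: measurableT_comp (mf c) _.
  apply: measurable_fun_pair; last exact: measurable_snd.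
  exact: measurableT_comp measurable_fst measurable_fst.
have K2i v : qintegrable mu2 (fun z => osc nu2 kap2 (th2 z.2 v) (f z)).
  by apply: qintegrable_osc => //; apply: mth2_comp; [exact: measurable_snd|].
have hi v : qintegrable mu (h^~ v) by exact: (qintegrable_qint (K2i v)).
have FE u v : F (u, v) = qint mu (fun s => osc nu1 kap1 (th1 s u) (h s v)).
  have K12i : qintegrable mu2 (fun z => osc nu1 kap1 (th1 z.1 u)
      (osc nu2 kap2 (th2 z.2 v) (f z))).
    by apply: qintegrable_osc => //; apply: mth1_comp; [exact: measurable_fst|].
  rewrite /F /= (qint12 K12i); apply: ae_eq_qint.
  - exact: (qmeasurable_qint mu (qintegrable_measurable K12i)).
  - apply: qmeasurable_osc; first exact: mth1_comp.
    exact: (qintegrable_measurable (hi v)).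
  have := ae_qintegrable (K2i v).
  apply: (@filterS _ _ (ae_filter_ringOfSetsType mu)) => s /= K2is.
  by rewrite qint_osc.
pose G1 s v := qint mu (fun u => osc nu1 kap1 (- th1 s u) (F (u, v))).
have K1i s : qintegrable mu2 (fun w => osc nu1 kap1 (- th1 s w.1) (F w)).
  apply: qintegrable_osc => //; apply: measurableT_comp => //.
  by apply: mth1_comp; [|exact: measurable_fst].
have G1i s : qintegrable mu (G1 s).
  exact: (qintegrable_qint (qintegrable_swap (K1i s))).
have mG1 : qmeasurable (fun z : R * R => G1 z.1 z.2).
  apply: (qmeasurable_qint mu (f := fun z : (R * R) * R =>
    osc nu1 kap1 (- th1 z.1.1 z.2) (F (z.2, z.1.2)))).
  apply: qmeasurable_osc.
    apply: measurableT_comp => //; apply: mth1_comp; last exact: measurable_snd.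
    exact: measurableT_comp measurable_fst measurable_fst.
  move=> c; apply: measurableT_comp (mF c) _.
  apply: measurable_fun_pair; first exact: measurable_snd.
  exact: measurableT_comp measurable_snd measurable_fst.
(* The first inversion holds for almost every [v], the second one needs it for almost
   every [s]. *)
have G1h : {ae mu, forall s, {ae mu, forall v, G1 s v = h s v}}.
  apply/(ae_prod1 mu mu (measurable_qeq mG1 mh)).
  apply/(ae_prod2 mu mu (measurable_qeq mG1 mh)).
  have := ae_qintegrable (qintegrable_swap Fi).
  apply: (@filterS _ _ (ae_filter_ringOfSetsType mu)) => v /= Fiv.
  have FvE : (fun u => F (u, v)) =
      (fun u => qint mu (fun s => osc nu1 kap1 (th1 s u) (h s v))).
    by apply/funext => u; exact: FE.
  have := inv1 (hi v); rewrite -FvE => /(_ Fiv).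
  apply: (@filterS _ _ (ae_filter_ringOfSetsType mu)) => s /=.
  exact.
pose G z := qint mu2 (fun w => osc nu2 kap2 (- th2 z.2 w.2)
  (osc nu1 kap1 (- th1 z.1 w.1) (F w))).
have GE s t : G (s, t) = qint mu (fun v => osc nu2 kap2 (- th2 t v) (G1 s v)).
  have K21i : qintegrable mu2 (fun w => osc nu2 kap2 (- th2 t w.2)
      (osc nu1 kap1 (- th1 s w.1) (F w))).
    apply: qintegrable_osc => //; apply: measurableT_comp => //.
    by apply: mth2_comp; [|exact: measurable_snd].
  rewrite /G /= (qint21 K21i); apply: ae_eq_qint.
  - exact: (qmeasurable_qint mu (qintegrable_measurable (qintegrable_swap K21i))).
  - apply: qmeasurable_osc; first by apply: measurableT_comp => //; exact: mth2_comp.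
    exact: (qintegrable_measurable (G1i s)).
  have := ae_qintegrable (qintegrable_swap (K1i s)).
  apply: (@filterS _ _ (ae_filter_ringOfSetsType mu)) => v /= K1is.
  by rewrite qint_osc.
(* Measurability in the parameter is obtained one integration at a time. *)
have mG : qmeasurable G.
  rewrite (_ : G = (fun z => qint mu (fun v =>
      osc nu2 kap2 (- th2 z.2 v) (G1 z.1 v)))); last by apply/funext => -[s t].
  apply: (qmeasurable_qint mu (f := fun z : (R * R) * R =>
    osc nu2 kap2 (- th2 z.1.2 z.2) (G1 z.1.1 z.2))).
  apply: qmeasurable_osc.
    apply: measurableT_comp => //; apply: mth2_comp; last exact: measurable_snd.
    exact: measurableT_comp measurable_snd measurable_fst.
  have msv : measurable_fun setT (fun z : (R * R) * R => (z.1.1, z.2)).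
    apply: measurable_fun_pair; last exact: measurable_snd.
    exact: measurableT_comp measurable_fst measurable_fst.
  by move=> c; have := measurableT_comp (mG1 c) msv.
apply/(ae_prod1 mu mu (measurable_qeq mf mG)).
have : {ae mu, forall s, qintegrable mu (fun t => f (s, t)) /\
    {ae mu, forall v, G1 s v = h s v}}.
  exact: (@filterI _ _ (ae_filter_ringOfSetsType mu) _ _ (ae_qintegrable fi) G1h).
apply: (@filterS _ _ (ae_filter_ringOfSetsType mu)) => s /= [fis G1hs].
have mhs : qmeasurable (h s) by exact: (qmeasurable_section1 s mh).
have hG1s : {ae mu, forall v, h s v = G1 s v}.
  move: G1hs; apply: (@filterS _ _ (ae_filter_ringOfSetsType mu)) => v /=; exact: esym.
(* [h s] inherits its integrability from the partial inverse transform of [F]. *)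
have his : qintegrable mu (h s).
  exact: (@ae_eq_qintegrable _ _ R mu (h s) (G1 s) mhs (G1i s) hG1s).
have := inv2 fis his.
apply: (@filterS _ _ (ae_filter_ringOfSetsType mu)) => t /= <-.
rewrite -/(G (s, t)) GE; apply: ae_eq_qint.
- apply: qmeasurable_osc; first by apply: measurableT_comp => //; exact: mth2_comp.
  exact: mhs.
- apply: qmeasurable_osc; first by apply: measurableT_comp => //; exact: mth2_comp.
  exact: (qintegrable_measurable (G1i s)).
move: hG1s; apply: (@filterS _ _ (ae_filter_ringOfSetsType mu)) => v /= hE.
by rewrite -hE.
Qed.

End PlaneInversion.

(** * The kernels of the linear canonical transform *)

Section Kernel.
Context {R : realType}.
Implicit Types (mu q : quat R) (A : 'M[R]_2).

Lemma invmx2_det1 A : \det A = 1 ->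
  [/\ invmx A 0 0 = A 1 1, invmx A 0 1 = - A 0 1 & invmx A 1 1 = A 0 0].
Proof.
move=> detA; rewrite /invmx unitmxE detA unitr1 invr1 scale1r.
have l0 : lift 0 0 = 1 :> 'I_2 by apply/val_inj.
have l1 : lift 1 0 = 0 :> 'I_2 by apply/val_inj.
split; rewrite mxE /cofactor det_mx11 !mxE ?l0 ?l1 /=.
- by rewrite expr0 mul1r.
- by rewrite expr1 mulN1r.
- by rewrite sqrrN expr1n mul1r.
Qed.

Lemma quat_scale_expi_inv mu (s th : R) : mu * mu = -1 -> s != 0 ->
  (s *: quat_expi mu th)^-1 = s^-1 *: quat_expi mu (- th).
Proof.
move=> mu2 s0.
have xy : s *: quat_expi mu th * (s^-1 *: quat_expi mu (- th)) = 1.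
  by rewrite -scalerAl -scalerAr scalerA mulfV// -quat_expiD// subrr quat_expi0 scale1r.
have yx : (s^-1 *: quat_expi mu (- th)) * (s *: quat_expi mu th) = 1.
  by rewrite -scalerAl -scalerAr scalerA mulVf// -quat_expiD// addNr quat_expi0 scale1r.
have xU : s *: quat_expi mu th \is a GRing.unit.
  by apply/unitrP; exists (s^-1 *: quat_expi mu (- th)).
by rewrite -[LHS]mulr1 -[X in _ * X]xy mulKr.
Qed.

Definition qlct_norm (b : R) : R := (Num.sqrt (2 * pi * b))^-1.

(** The term [pi / 4] is the argument of the square root in the denominator of the
    kernel, put together with the phase. *)
Definition qlct_phase A (x y : R) : R :=
  (A 0 0 / (2 * A 0 1) * x ^+ 2 - pi / 4) - (A 0 1)^-1 * x * y +
  A 1 1 / (2 * A 0 1) * y ^+ 2.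

Lemma qlct_kernelE mu A x y q : mu * mu = -1 -> 0 < A 0 1 ->
  qlct_kernel mu A x y * q = osc mu (qlct_norm (A 0 1)) (qlct_phase A x y) q.
Proof.
move=> mu2 b0; rewrite /qlct_kernel /quat_sqrt2pi gtr0_norm// gtr0_sg// mul1r.
have pb0 : 0 < 2 * pi * A 0 1 by rewrite !mulr_gt0// pi_gt0.
rewrite quat_scale_expi_inv//; last by rewrite gt_eqF// sqrtr_gt0.
rewrite /osc -/(qlct_norm _) -scalerAl -scalerAl; congr (_ *: _).
rewrite -quat_expiD//; congr (quat_expi mu _ * _).
rewrite /qlct_phase.
by move: (_ * x ^+ 2) (_ * x * y) (_ * y ^+ 2) (pi / 4) => *; ring.
Qed.

(** Inverting the matrix exchanges [a] and [d] and negates [b]; with the variables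
    exchanged as well, the phase changes sign and the normalization is unchanged. *)
Lemma qlct_kernel_invE mu A x y q : mu * mu = -1 -> \det A = 1 -> 0 < A 0 1 ->
  qlct_kernel mu (invmx A) y x * q =
  osc mu (qlct_norm (A 0 1)) (- qlct_phase A x y) q.
Proof.
move=> mu2 detA b0; have [A00 A01 A11] := invmx2_det1 detA.
rewrite /qlct_kernel /quat_sqrt2pi A00 A01 A11 normrN sgrN.
rewrite gtr0_norm// gtr0_sg// mulN1r.
have pb0 : 0 < 2 * pi * A 0 1 by rewrite !mulr_gt0// pi_gt0.
rewrite quat_scale_expi_inv//; last by rewrite gt_eqF// sqrtr_gt0.
rewrite /osc -/(qlct_norm _) -scalerAl -scalerAl; congr (_ *: _).
rewrite -quat_expiD//; congr (quat_expi mu _ * _).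
rewrite /qlct_phase mulrN !invrN !mulrN !mulNr !opprK [_ * y * x]mulrAC.
by move: (_ * x ^+ 2) (_ * x * y) (_ * y ^+ 2) (pi / 4) => *; ring.
Qed.

Lemma qlct_norm_sqr (b : R) : 0 < b -> qlct_norm b ^+ 2 = b^-1 / (2 * pi).
Proof.
move=> b0; have pb0 : 0 < 2 * pi * b by rewrite !mulr_gt0// pi_gt0.
by rewrite /qlct_norm exprVn sqr_sqrtr ?ltW// invfM mulrC.
Qed.

Lemma measurable_qlct_phase A :
  measurable_fun setT (fun z : R * R => qlct_phase A z.1 z.2).
Proof.
apply: measurable_funD; [apply: measurable_funB; [apply: measurable_funB|]|] => //.
- by apply: measurable_funM => //; exact: measurable_funX.
- by apply: measurable_funM => //; exact: measurable_funM.
- by apply: measurable_funM => //; exact: measurable_funX.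
Qed.

Lemma qlct_inversion1 mu A : mu * mu = -1 -> 0 < A 0 1 ->
  let kap := qlct_norm (A 0 1) in
  forall g : R -> quat R, qintegrable lebesgue_measure g ->
  let h y := qint lebesgue_measure (fun x => osc mu kap (qlct_phase A x y) (g x)) in
  qintegrable lebesgue_measure h ->
  {ae lebesgue_measure, forall x,
    qint lebesgue_measure (fun y => osc mu kap (- qlct_phase A x y) (h y)) = g x}.
Proof.
move=> mu2 b0 kap g gi; apply: chirp_inversion => //.
- by rewrite invr_gt0.
- exact: qlct_norm_sqr.
- by apply: measurable_funB => //; apply: measurable_funM => //; exact: measurable_funX.
- by apply: measurable_funM => //; exact: measurable_funX.
Qed.

End Kernel.

Theorem theorem3p14 (R : realType) (A1 A2 : 'M[R]_2)
    (detA1 : \det A1 = 1) (detA2 : \det A2 = 1)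
    (b1_gt0 : 0 < A1 0 1) (b2_gt0 : 0 < A2 0 1)
    (f : R * R -> quat R)
    (f_L1 : quat_L1 f) (Lf_L1 : quat_L1 (left_qlct A1 A2 f)) :
  {ae lebesgue2 R, forall z : R * R,
     f z = quat_integral (fun w : R * R =>
             qlct_kernel quatj (invmx A2) w.2 z.2 *
             qlct_kernel quati (invmx A1) w.1 z.1 *
             left_qlct A1 A2 f w)}.
Proof.
have ii := @quat_mulii R; have jj := @quat_muljj R.
have [f1 f2 f3 f4 foo] := f_L1.
have mf c : nullmeasurable (lebesgue2 R) (fun z => qcoord c (f z)).
  by case: c; [exact: f1|exact: f2|exact: f3|exact: f4].
have [N [mN N0 f'i]] := qmodification mf foo.
set f' := patch _ _ f in f'i.
have f'E z : ~ N z -> f' z = f z by move=> Nz; rewrite /f' /patch mem_set.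
pose F w := qint (lebesgue2 R) (fun z : R * R =>
  osc quati (qlct_norm (A1 0 1)) (qlct_phase A1 z.1 w.1)
  (osc quatj (qlct_norm (A2 0 1)) (qlct_phase A2 z.2 w.2) (f' z))).
have LF : left_qlct A1 A2 f = F.
  apply/funext => w.
  pose K (z : R * R) := qlct_kernel quati A1 z.1 w.1 * qlct_kernel quatj A2 z.2 w.2.
  transitivity (qint (lebesgue2 R) (fun z => K z * f z)); first by [].
  rewrite (@qint_setC_null _ _ R (lebesgue2 R) N K f mN N0); apply: eq_qint => z.
  by rewrite /K -mulrA !qlct_kernelE.
have mF : qmeasurable F.
  exact: (qmeasurable_plane_transform _ _ _ _ (measurable_qlct_phase A1)
    (measurable_qlct_phase A2) f'i).
have Fi : qintegrable (lebesgue2 R) F.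
  have [_ _ _ _ Foo] := Lf_L1; rewrite LF in Foo.
  move=> c; apply/integrableP; split; first by apply/measurable_EFinP; exact: (mF c).
  apply: le_lt_trans Foo; apply: ge0_le_integral_any => // z.
  by rewrite lee_fin; exact: qcoord_le_abs.
have := plane_inversion (measurable_qlct_phase A1) (measurable_qlct_phase A2)
  (qlct_inversion1 ii b1_gt0) (qlct_inversion1 jj b2_gt0) f'i Fi.
have : {ae lebesgue2 R, forall z, f' z = f z}.
  exists N; split => // z /=; apply: contra_notP; exact: f'E.
apply: (@filterS2 _ _ (ae_filter_ringOfSetsType (lebesgue2 R))) => z /= -> ->.
rewrite LF; apply: eq_qint => w.
by rewrite -mulrA qlct_kernel_invE// qlct_kernel_invE.
Qed.
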